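(* The $\Sigma_4$-theory of $\mathbf Y^*=\langle\mathcal P,\le,[1]+[1]\rangle$ (the set of $\Sigma_4$-sentences in the language $\{\le,[1]+[1]\}$ true in $\mathbf Y^*$) is undecidable.
   Context: $\mathcal P$ is the set of all integer partitions, including the empty partition; a partition is a nonincreasing finite sequence of positive integers. Young's lattice $\mathbf Y=\langle\mathcal P,\le\rangle$ has $(s_1,\dots,s_r)\le(n_1,\dots,n_t)$ iff $r\le t$ and $s_i\le n_i$ for all $i\le r$; $\mathbf Y^*$ is $\mathbf Y$ expanded by a constant symbol interpreted as the partition $[1]+[1]=(1,1)$. A $\Sigma_n$-sentence is a sentence in prenex form with $n$ alternating quantifier blocks, the outermost existential, and a quantifier-free matrix. *)

(* Defs.v *)
From mathcomp Require Import all_boot.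
Set Implicit Arguments. Unset Strict Implicit. Unset Printing Implicit Defensive.

Definition is_partition (s : seq nat) : bool :=
  sorted geq s && all (fun x => 0 < x) s.

Record partition := Partition { parts : seq nat; partsP : is_partition parts }.

Definition young_le (p q : partition) : Prop :=
  size (parts p) <= size (parts q) /\
  forall i, i < size (parts p) -> nth 0 (parts p) i <= nth 0 (parts q) i.

Lemma is_partition_11 : is_partition [:: 1; 1]. Proof. by []. Qed.
Definition part11 : partition := Partition is_partition_11.

Inductive term : Type :=
| TVar : nat -> term
| TConst : term.

Inductive form : Type :=
| FLe  : term -> term -> form
| FEq  : term -> term -> form
| FNot : form -> form
| FAnd : form -> form -> form
| FOr  : form -> form -> form
| FEx  : nat -> form -> form
| FAll : nat -> form -> form.

Definition env := nat -> partition.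

Definition eval_term (e : env) (t : term) : partition :=
  match t with TVar n => e n | TConst => part11 end.

Definition upd (e : env) (x : nat) (a : partition) : env :=
  fun y => if y == x then a else e y.

Fixpoint holds (e : env) (f : form) : Prop :=
  match f with
  | FLe t u => young_le (eval_term e t) (eval_term e u)
  | FEq t u => eval_term e t = eval_term e u
  | FNot g => ~ holds e g
  | FAnd g h => holds e g /\ holds e h
  | FOr g h => holds e g \/ holds e h
  | FEx x g => exists a : partition, holds (upd e x a) g
  | FAll x g => forall a : partition, holds (upd e x a) g
  end.

Definition term_has_var (x : nat) (t : term) : bool :=
  match t with TVar n => n == x | TConst => false end.

Fixpoint free_in (x : nat) (f : form) : bool :=
  match f with
  | FLe t u | FEq t u => term_has_var x t || term_has_var x u
  | FNot g => free_in x g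
  | FAnd g h | FOr g h => free_in x g || free_in x h
  | FEx y g | FAll y g => (y != x) && free_in x g
  end.

Definition sentence (f : form) : Prop := forall x, ~~ free_in x f.

(* Truth in Y* of a sentence (independent of the environment). *)
Definition true_in_Ystar (f : form) : Prop := forall e : env, holds e f.

Fixpoint qfree (f : form) : bool :=
  match f with
  | FLe _ _ | FEq _ _ => true
  | FNot g => qfree g
  | FAnd g h | FOr g h => qfree g && qfree h
  | FEx _ _ | FAll _ _ => false
  end.

(* Prenex Sigma_n / Pi_n: n nonempty alternating quantifier blocks
   (outermost existential for Sigma_n, universal for Pi_n) followed by a
   quantifier-free matrix. Sigma_0 = Pi_0 = quantifier-free. *)
Inductive Sigma : nat -> form -> Prop :=
| Sigma0 f : qfree f -> Sigma 0 f
| SigmaStart n x f : Pi n f -> Sigma n.+1 (FEx x f)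
| SigmaMore n x f : Sigma n.+1 f -> Sigma n.+1 (FEx x f)
with Pi : nat -> form -> Prop :=
| Pi0 f : qfree f -> Pi 0 f
| PiStart n x f : Sigma n f -> Pi n.+1 (FAll x f)
| PiMore n x f : Pi n.+1 f -> Pi n.+1 (FAll x f).

Definition cpair (a b : nat) : nat := ((a + b) * (a + b).+1)./2 + b.

Definition code_term (t : term) : nat :=
  match t with TVar n => cpair 0 n | TConst => cpair 1 0 end.

Fixpoint code (f : form) : nat :=
  match f with
  | FLe t u => cpair 0 (cpair (code_term t) (code_term u))
  | FEq t u => cpair 1 (cpair (code_term t) (code_term u))
  | FNot g => cpair 2 (code g)
  | FAnd g h => cpair 3 (cpair (code g) (code h))
  | FOr g h => cpair 4 (cpair (code g) (code h))
  | FEx x g => cpair 5 (cpair x (code g))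
  | FAll x g => cpair 6 (cpair x (code g))
  end.

Inductive recf : Type :=
| RZero : recf
| RSucc : recf
| RProj : nat -> recf
| RComp : recf -> list recf -> recf
| RPrim : recf -> recf -> recf
| RMu   : recf -> recf.

Inductive reval : recf -> list nat -> nat -> Prop :=
| ev_zero v : reval RZero v 0
| ev_succ x v : reval RSucc (x :: v) x.+1
| ev_proj i v : reval (RProj i) v (nth 0 v i)
| ev_comp f gs v ys y :
    reval_list gs v ys -> reval f ys y -> reval (RComp f gs) v y
| ev_prim0 f g v y : reval f v y -> reval (RPrim f g) (0 :: v) y
| ev_primS f g n v z y :
    reval (RPrim f g) (n :: v) z -> reval g (n :: z :: v) y ->
    reval (RPrim f g) (n.+1 :: v) y
| ev_mu f v y :
    reval f (y :: v) 0 ->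
    (forall k, k < y -> exists m, reval f (k :: v) m.+1) ->
    reval (RMu f) v y
with reval_list : list recf -> list nat -> list nat -> Prop :=
| evl_nil v : reval_list [::] v [::]
| evl_cons g gs v y ys :
    reval g v y -> reval_list gs v ys -> reval_list (g :: gs) v (y :: ys).

Definition recursive_set (P : nat -> Prop) : Prop :=
  exists f : recf, forall n,
    (P n -> reval f [:: n] 1) /\ (~ P n -> reval f [:: n] 0).

Definition Sigma_theory_Ystar (n : nat) (k : nat) : Prop :=
  exists f : form, code f = k /\ sentence f /\ Sigma n f /\ true_in_Ystar f.

(* Main.v *)
Require Import Defs.
From mathcomp Require Import all_boot.
From mathcomp Require Import zify.
From Stdlib Require Import Classical FunctionalExtensionality.

(** Young's lattice can existentially quantify over the run of a counter machine.
    Store a run of length T in partitions with T + 1 rows: a reference partition z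
    with rows T + 1, T, .., 1, and for each register r a partition whose row t
    exceeds row t of z by the value of r at time t.  A step then only compares
    row t with row t + 1 (they differ by 0, 1 or 2 according to whether the
    register grows, stays or shrinks), and such comparisons can be tested on
    rectangles, which have a one-quantifier definition from the rows and columns
    bounding them; the constant (1,1) separates rows from columns.  Hence
    "the machine accepts" is expressed by an E A E (a fortiori Sigma_4) sentence.

    Undecidability follows by diagonalization, without a universal machine: for
    every recursive g there is a matrix B, depending only on g, such that
    the sentence S(B) stating that the machine of g accepts the input
    k = code B is true iff g(k) = 0.  Its code is a recursive function d of k,
    so g = D o d contradicts the correctness of a putative decision procedure D. *)

Local Notation partition := Defs.partition.

(** * Evaluation of recursive functions: inversion and determinism *)

(** The list argument of [RComp] is nested, so a second predicate [Q] carries the induction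
    hypothesis along lists. *)
Lemma recf_nested_ind (P : recf -> Prop) (Q : seq recf -> Prop) :
  P RZero -> P RSucc -> (forall i, P (RProj i)) ->
  (forall f gs, P f -> Q gs -> P (RComp f gs)) ->
  (forall f g, P f -> P g -> P (RPrim f g)) ->
  (forall f, P f -> P (RMu f)) ->
  Q [::] -> (forall g gs, P g -> Q gs -> Q (g :: gs)) ->
  forall f, P f.
Proof.
move=> P0 PS Pp Pc Pr Pm Q0 QS.
fix IH 1; case=> [||i|f gs|f g|f]; [exact: P0|exact: PS|exact: Pp| |exact: Pr|exact: Pm].
apply: Pc; first exact: IH.
by elim: gs => [|g gs IHgs]; [exact: Q0|exact: QS].
Qed.

Lemma reval_zeroE v y : reval RZero v y <-> y = 0.
Proof. by split=> [H|->]; [inversion H|constructor]. Qed.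

Lemma reval_succE x v y : reval RSucc (x :: v) y <-> y = x.+1.
Proof. by split=> [H|->]; [inversion H|constructor]. Qed.

Lemma reval_succ_nil y : ~ reval RSucc [::] y.
Proof. by move=> H; inversion H. Qed.

Lemma reval_projE i v y : reval (RProj i) v y <-> y = nth 0 v i.
Proof. by split=> [H|->]; [inversion H|constructor]. Qed.

Lemma reval_compE f gs v y :
  reval (RComp f gs) v y <-> exists2 ys, reval_list gs v ys & reval f ys y.
Proof.
split=> [H|[ys H1 H2]]; last exact: ev_comp H1 H2.
by inversion H; subst; exists ys.
Qed.

Lemma reval_prim0E f g v y : reval (RPrim f g) (0 :: v) y <-> reval f v y.
Proof. by split=> [H|H]; [inversion H; subst|exact: ev_prim0]. Qed.

Lemma reval_primSE f g n v y :
  reval (RPrim f g) (n.+1 :: v) y <->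
  exists2 z, reval (RPrim f g) (n :: v) z & reval g (n :: z :: v) y.
Proof.
split=> [H|[z H1 H2]]; last exact: ev_primS H1 H2.
by inversion H; subst; exists z.
Qed.

Lemma reval_prim_nil f g y : ~ reval (RPrim f g) [::] y.
Proof. by move=> H; inversion H. Qed.

Lemma reval_muE f v y :
  reval (RMu f) v y <->
  reval f (y :: v) 0 /\
  (forall k, k < y -> exists m, reval f (k :: v) m.+1).
Proof. by split=> [H|[H1 H2]]; [inversion H; subst|exact: ev_mu]. Qed.

Lemma reval_list_nilE v ys : reval_list [::] v ys <-> ys = [::].
Proof. by split=> [H|->]; [inversion H|constructor]. Qed.

Lemma reval_list_consE g gs v ys :
  reval_list (g :: gs) v ys <->
  exists y ys', [/\ ys = y :: ys', reval g v y & reval_list gs v ys'].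
Proof.
split=> [H|[y [ys' [-> H1 H2]]]]; last exact: evl_cons.
by inversion H; subst; exists y, ys0.
Qed.

(** For [RMu], the smaller of two distinct results would make [f] take both the value 0 and a
    positive value there. The final contradiction rests on this lemma: a decider cannot answer both
    0 and 1. *)
Lemma reval_functional f v y y' : reval f v y -> reval f v y' -> y = y'.
Proof.
move: f v y y'.
apply: (@recf_nested_ind
  (fun f => forall v y y', reval f v y -> reval f v y' -> y = y')
  (fun gs => forall v ys ys',
     reval_list gs v ys -> reval_list gs v ys' -> ys = ys')).
- by move=> v y y' /reval_zeroE-> /reval_zeroE->.
- move=> [|x v] y y'; first by move/reval_succ_nil.
  by move=> /reval_succE-> /reval_succE->.
- by move=> i v y y' /reval_projE-> /reval_projE->.
- move=> f gs IHf IHgs v y y' /reval_compE[ys Hs Hy] /reval_compE[ys' Hs' Hy'].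
  by rewrite (IHgs _ _ _ Hs' Hs) in Hy'; apply: IHf Hy Hy'.
- move=> f g IHf IHg [|n v] y y'; first by move/reval_prim_nil.
  elim: n y y' => [|n IHn] y y'.
    by move=> /reval_prim0E H1 /reval_prim0E; apply: IHf H1.
  move=> /reval_primSE[z Hz Hy] /reval_primSE[z' Hz' Hy'].
  by rewrite (IHn _ _ Hz' Hz) in Hy'; apply: IHg Hy Hy'.
- move=> f IHf v y y' /reval_muE[H1 H2] /reval_muE[H1' H2'].
  have [lt|gt|//] := ltngtP y y'.
  + by have [m /IHf/(_ H1)] := H2' _ lt.
  + by have [m /IHf/(_ H1')] := H2 _ gt.
- by move=> v ys ys' /reval_list_nilE-> /reval_list_nilE->.
- move=> g gs IHg IHgs v ys ys'.
  move=> /reval_list_consE[y [s [-> Hy Hs]]].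
  move=> /reval_list_consE[y' [s' [-> Hy' Hs']]].
  by rewrite (IHg _ _ _ Hy Hy') (IHgs _ _ _ Hs Hs').
Qed.

Lemma reval_list_size gs v ys : reval_list gs v ys -> size ys = size gs.
Proof.
elim: gs ys => [|g gs IH] ys; first by move/reval_list_nilE->.
by move=> /reval_list_consE[y [s [-> _ /IH /= ->]]].
Qed.

(** * Regular programs over registers *)

Inductive act : Type :=
| AInc of nat
| ADec of nat
| AEq of nat & nat.

Inductive prog : Type :=
| PAct of act
| PSeq of prog & prog
| PStar of prog.

Definition state := nat -> nat.

Definition setr (s : state) (r n : nat) : state :=
  fun x => if x == r then n else s x.

Definition act_sem (a : act) (s s' : state) : Prop :=
  match a with
  | AInc r => s' = setr s r (s r).+1
  | ADec r => 0 < s r /\ s' = setr s r (s r).-1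
  | AEq r q => s r = s q /\ s' = s
  end.

Inductive rtc {T : Type} (R : T -> T -> Prop) : T -> T -> Prop :=
| rtc_refl x : rtc R x x
| rtc_step x y z : R x y -> rtc R y z -> rtc R x z.

Lemma rtc_trans T (R : T -> T -> Prop) x y z : rtc R x y -> rtc R y z -> rtc R x z.
Proof.
by elim=> // {}x u {}y Rxu _ IH Ryz; apply: rtc_step Rxu (IH Ryz).
Qed.

Lemma rtc_snoc T (R : T -> T -> Prop) x y z : rtc R x y -> R y z -> rtc R x z.
Proof. by move=> H1 H2; apply: rtc_trans H1 (rtc_step _ _ _ _ H2 (rtc_refl _ _)). Qed.

Fixpoint sem (p : prog) : state -> state -> Prop :=
  match p with
  | PAct a => act_sem a
  | PSeq p q => fun s s' => exists2 u, sem p s u & sem q u s'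
  | PStar p => rtc (sem p)
  end.

Ltac state_eq :=
  apply: functional_extensionality => ?; rewrite /setr;
  repeat case: eqP => ? //; subst; try lia.

(* Register 0 is never written and holds 0, so [AEq r 0] is a zero test. *)
Definition pskip : prog := PAct (AEq 0 0).
(** Guess and check: [b] is increased an arbitrary number of times, and the equality test keeps only
    the run that reached the value of [a]. A failing test leaves no successor state. *)
Definition pcopy (a b : nat) : prog := PSeq (PStar (PAct (AInc b))) (PAct (AEq a b)).
Definition pclear (b : nat) : prog := PSeq (PStar (PAct (ADec b))) (PAct (AEq b 0)).
Definition pclears (bs : seq nat) : prog :=
  foldr (fun b p => PSeq (pclear b) p) pskip bs.

Lemma sem_skip s s' : sem pskip s s' <-> s' = s.
Proof. by split=> [[]|->]. Qed.

Lemma setr_setr s r n n' : setr (setr s r n) r n' = setr s r n'.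
Proof. by state_eq. Qed.

Lemma setr_id s r : setr s r (s r) = s.
Proof. by state_eq. Qed.

Lemma setr_eq s r n : setr s r n r = n.
Proof. by rewrite /setr eqxx. Qed.

Lemma sem_star_inc b s s' :
  rtc (act_sem (AInc b)) s s' <-> exists2 n, s b <= n & s' = setr s b n.
Proof.
split.
  elim=> [x|x y z /= -> _ [n]]; first by exists (x b); rewrite ?setr_id.
  by rewrite setr_eq setr_setr => ltn ->; exists n => //; apply: ltnW.
case=> n len ->; rewrite -(subnKC len); elim: (n - s b) => [|j IH].
  by rewrite addn0 setr_id; constructor.
by apply: rtc_snoc IH _; rewrite /= setr_eq setr_setr addnS.
Qed.

Lemma sem_star_dec b s s' :
  rtc (act_sem (ADec b)) s s' <-> exists2 n, n <= s b & s' = setr s b n.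
Proof.
split.
  elim=> [x|x y z /= [pos ->] _ [n]]; first by exists (x b); rewrite ?setr_id.
  by rewrite setr_eq setr_setr => ltn ->; exists n => //; lia.
case=> n len ->; have -> : n = s b - (s b - n) by lia.
have : s b - n <= s b by lia.
elim: (s b - n) => [|j IH] lej.
  by rewrite subn0 setr_id; constructor.
apply: rtc_snoc (IH (ltnW lej)) _; rewrite /= setr_eq setr_setr; split; first lia.
by congr setr; lia.
Qed.

Lemma sem_copy a b s s' : a != b -> s b = 0 ->
  sem (pcopy a b) s s' <-> s' = setr s b (s a).
Proof.
move=> neq sb0; split=> [[u /sem_star_inc[n _ ->]] /=|->].
  by rewrite setr_eq /setr (negPf neq) => -[-> ->].
exists (setr s b (s a)); first by apply/sem_star_inc; exists (s a); rewrite ?sb0.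
by rewrite /= setr_eq /setr (negPf neq).
Qed.

Lemma sem_clear b s s' : 0 < b -> s 0 = 0 ->
  sem (pclear b) s s' <-> s' = setr s b 0.
Proof.
move=> bpos s00; have neq : (0 == b) = false by lia.
split=> [[u /sem_star_dec[n _ ->]] /=|->].
  by rewrite setr_eq /setr neq s00 => -[-> ->].
exists (setr s b 0); first by apply/sem_star_dec; exists 0.
by rewrite /= setr_eq /setr neq s00.
Qed.

Lemma sem_clears bs s s' : all (ltn 0) bs -> s 0 = 0 ->
  sem (pclears bs) s s' <-> s' = fun x => if x \in bs then 0 else s x.
Proof.
elim: bs s s' => [|b bs IH] s s'.
  by move=> _ _; apply: iff_trans (sem_skip _ _) _.
rewrite [all _ _]/= => /andP[bpos bspos] s00.
change (sem (pclears (b :: bs)) s s') with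
  (exists2 u, sem (pclear b) s u & sem (pclears bs) u s').
have c0 : setr s b 0 0 = 0 by rewrite /setr; case: eqP.
have E : (fun x => if x \in bs then 0 else setr s b 0 x) =
         (fun x => if x \in b :: bs then 0 else s x).
  by apply: functional_extensionality => x; rewrite inE /setr; case: eqP; case: ifP.
split=> [[u /(sem_clear _ _ _ bpos s00)-> /(IH _ _ bspos c0)->]|->]; first exact: E.
exists (setr s b 0); first exact/sem_clear.
by apply/(IH _ _ bspos c0); rewrite E.
Qed.

(* [compile f args out base] uses the registers from [base] on as scratch space. *)
Fixpoint compile (f : recf) (args : seq nat) (out base : nat) : prog :=
  match f with
  | RZero => pskip
  | RSucc => if args is a :: _ then PSeq (pcopy a out) (PAct (AInc out))
             else PAct (ADec base)
  | RProj i => pcopy (nth 0 args i) out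
  | RComp f gs =>
      PSeq ((fix compiles hs k := match hs with
             | [::] => pskip
             | h :: hs' => PSeq (compile h args k (base + size gs)) (compiles hs' k.+1)
             end) gs base)
        (PSeq (compile f (iota base (size gs)) out (base + size gs))
              (pclears (iota base (size gs))))
  | RPrim f g =>
      if args is a :: v then
        PSeq (compile f v out base.+2)
          (PSeq (PStar (PSeq (compile g (base :: out :: v) base.+1 base.+2)
                   (PSeq (pclear out) (PSeq (pcopy base.+1 out)
                     (PSeq (pclear base.+1) (PAct (AInc base)))))))
            (PSeq (PAct (AEq base a)) (pclear base)))
      else PAct (ADec base)
  | RMu f =>
      PSeq (PStar (PSeq (compile f (out :: args) base base.+1)
                (PSeq (PAct (ADec base)) (PSeq (pclear base) (PAct (AInc out))))))
        (PSeq (compile f (out :: args) base base.+1) (PAct (AEq base 0)))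
  end.

(** * Correctness of the compiler *)

(** The calling convention. The output and scratch registers start at 0 because results are produced
    by counting upwards. *)
Definition comp_ready (args : seq nat) (out base : nat) (s : state) : Prop :=
  [/\ s 0 = 0, (forall r, base <= r -> s r = 0), s out = 0, 0 < out < base
    & (out \notin args) && all (gtn base) args].

(** The equation for [s'] also says that the scratch registers are back at 0. Divergence of [f]
    appears as the absence of a final state. *)
Definition comp_correct (f : recf) : Prop :=
  forall args out base s s', comp_ready args out base s ->
  (sem (compile f args out base) s s' <->
   exists2 y, reval f (map s args) y & s' = setr s out y).

Lemma setr_neq s r n x : x != r -> setr s r n x = s x.
Proof. by rewrite /setr => /negPf->. Qed.

Lemma map_setr s r n (args : seq nat) : r \notin args ->
  map (setr s r n) args = map s args.
Proof.
move=> nin; apply/eq_in_map => x xin; apply: setr_neq.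
by apply: contraNneq nin => <-.
Qed.

Lemma notin_above (args : seq nat) b r : all (gtn b) args -> b <= r -> r \notin args.
Proof. by move=> /allP H le; apply/negP => /H /=; lia. Qed.

Lemma all_above (args : seq nat) b b' : all (gtn b) args -> b <= b' -> all (gtn b') args.
Proof. by move=> /allP H le; apply/allP => x /H /=; lia. Qed.

Lemma comp_correct_zero : comp_correct RZero.
Proof.
move=> args out base s s' [_ _ out0 _ _]; rewrite sem_skip.
split=> [->|[y /reval_zeroE-> ->]]; last by rewrite -out0 setr_id.
by exists 0; [apply/reval_zeroE|rewrite -out0 setr_id].
Qed.

Lemma comp_correct_succ : comp_correct RSucc.
Proof.
move=> [|a args] out base s s' [s00 sb out0 /andP[out_gt0 lt_out] /andP[nin ltb]].
  (* Without arguments [RSucc] has no value; the compiled code decrements a scratch register holding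
     0, which blocks. *)
  split=> [[]|[y /reval_succ_nil//]].
  by rewrite sb.
have neq : a != out by move: nin; rewrite inE eq_sym negb_or => /andP[].
split=> [[u /(sem_copy _ _ _ _ neq out0)-> /= ->]|[y /reval_succE-> ->]].
  by rewrite setr_eq setr_setr; exists (s a).+1 => //; apply/reval_succE.
exists (setr s out (s a)); first exact/sem_copy.
by rewrite /= setr_eq setr_setr.
Qed.

Lemma comp_correct_proj i : comp_correct (RProj i).
Proof.
move=> args out base s s' [s00 sb out0 /andP[out_gt0 lt_out] /andP[nin ltb]].
have neq : nth 0 args i != out.
  have [lti|gei] := ltnP i (size args).
    by apply: contraNneq nin => <-; apply: mem_nth.
  by rewrite nth_default //; lia.
(* Out of range, the default index 0 names register 0, whose content 0 is the default value of the
   projection. *)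
have E : nth 0 (map s args) i = s (nth 0 args i).
  have [lti|gei] := ltnP i (size args); first by rewrite (nth_map 0).
  by rewrite !nth_default ?size_map.
apply: iff_trans (sem_copy _ _ _ _ neq out0) _; split=> [->|[y /reval_projE-> ->]].
  by exists (s (nth 0 args i)) => //; apply/reval_projE.
by rewrite E.
Qed.

Definition setl (s : state) (k : nat) (ys : seq nat) : state :=
  fun x => if k <= x < k + size ys then nth 0 ys (x - k) else s x.

Lemma setl_cons s k y ys : setl s k (y :: ys) = setl (setr s k y) k.+1 ys.
Proof.
apply: functional_extensionality => x; rewrite /setl /setr /=.
have [->|neq] := eqVneq x k.
  by rewrite ltnn /= subnn leqnn -{1}(addn0 k) ltn_add2l.
have -> : (k <= x) = (k < x) by lia.
rewrite addSnnS; case: ifP => // /andP[lt _].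
by have -> : x - k = (x - k.+1).+1 by lia.
Qed.

Lemma map_setl_iota s k ys : map (setl s k ys) (iota k (size ys)) = ys.
Proof.
apply: (@eq_from_nth _ 0) => [|i]; rewrite size_map size_iota // => lti.
rewrite (nth_map 0) ?size_iota // nth_iota // /setl leq_addr ltn_add2l lti.
by rewrite addKn.
Qed.

(** A named copy of the local fixpoint inside [compile], so that [RComp] can be treated by induction
    on the list. *)
Fixpoint compiles (gs : seq recf) (args : seq nat) (k base : nat) : prog :=
  match gs with
  | [::] => pskip
  | g :: gs' => PSeq (compile g args k base) (compiles gs' args k.+1 base)
  end.

Lemma comp_RComp f gs args out base :
  compile (RComp f gs) args out base =
  PSeq (compiles gs args base (base + size gs))
    (PSeq (compile f (iota base (size gs)) out (base + size gs))
          (pclears (iota base (size gs)))).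
Proof.
rewrite /=; congr PSeq; move: (base + size gs) => B.
by elim: gs base => //= g gs IH k; rewrite IH.
Qed.

(** The induction moves the target register [k] along the list, while the scratch area stays fixed
    above all targets. *)
Definition comps_correct (gs : seq recf) : Prop :=
  forall args k base s s', s 0 = 0 -> 0 < k -> (forall r, k <= r -> s r = 0) ->
  all (gtn k) args -> k + size gs <= base ->
  (sem (compiles gs args k base) s s' <->
   exists2 ys, reval_list gs (map s args) ys & s' = setl s k ys).

Lemma setl_nil s k : setl s k [::] = s.
Proof. by apply: functional_extensionality => x; rewrite /setl addn0; case: ifP => //; lia. Qed.

Lemma comps_correct_cons g gs :
  comp_correct g -> comps_correct gs -> comps_correct (g :: gs).
Proof.
move=> Hg Hgs args k base s s' s00 kpos sk ltk le /=.
rewrite /= in le.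
have nin : k \notin args by exact: notin_above ltk _.
have rdy : comp_ready args k base s.
  split=> //; [by move=> r ler; apply: sk; lia|exact: sk|lia|].
  by rewrite nin (all_above _ _ _ ltk) //; lia.
have Hrest u y w : u = setr s k y ->
  sem (compiles gs args k.+1 base) u w <->
  exists2 ys, reval_list gs (map s args) ys & w = setl s k (y :: ys).
  move=> ->; rewrite Hgs //.
  - by rewrite map_setr //; split=> -[ys H1 H2]; exists ys => //; rewrite H2 setl_cons.
  - by rewrite setr_neq //; lia.
  - by move=> r ltr; rewrite setr_neq ?sk //; lia.
  - exact: all_above ltk _.
  - by lia.
split=> [[u /(Hg _ _ _ _ _ rdy)[y Hy Eu] /(Hrest _ _ _ Eu)[ys Hys ->]]|].
  by exists (y :: ys) => //; apply/reval_list_consE; exists y, ys.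
case=> ys0 /reval_list_consE[y [ys [-> Hy Hys]] ->].
exists (setr s k y); first by apply/Hg => //; exists y.
by apply/(Hrest _ y _ erefl); exists ys.
Qed.

Lemma comp_correct_comp f gs :
  comp_correct f -> comps_correct gs -> comp_correct (RComp f gs).
Proof.
move=> Hf Hgs args out base s s' [s00 sb out0 /andP[out_gt0 lt_out] /andP[nin ltb]].
rewrite comp_RComp; set n := size gs; set L := iota base n.
have Hgs' := Hgs args base (base + n) s _ s00
  (ltnW (leq_ltn_trans out_gt0 lt_out)) sb ltb (leqnn _).
(* The second half of the run: once the block [L] holds the argument values, evaluating [f] and
   clearing [L] leaves only [out] changed. *)
have key ys u : size ys = n ->
  sem (PSeq (compile f L out (base + n)) (pclears L)) (setl s base ys) u <->
  exists2 y, reval f ys y & u = setr s out y.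
  move=> Sn; set t := setl s base ys.
  have t_lt r : r < base -> t r = s r by rewrite /t /setl; case: ifP => //; lia.
  have t_ge r : base + n <= r -> t r = 0.
    by rewrite /t /setl Sn; case: ifP => [|_ le]; [lia|apply: sb; lia].
  have memL x : (x \in L) = (base <= x < base + n) by rewrite mem_iota.
  have rdy : comp_ready L out (base + n) t.
    split=> //; [by rewrite t_lt //; lia|by rewrite t_lt|lia|].
    rewrite memL; apply/andP; split; first by lia.
    by apply/allP => x; rewrite memL /=; lia.
  have E : map t L = ys by rewrite /t /L -Sn map_setl_iota.
  have Hclr y v : sem (pclears L) (setr t out y) v <-> v = setr s out y.
    rewrite sem_clears.
    - suff -> : (fun x => if x \in L then 0 else setr t out y x) = setr s out y by [].
      apply: functional_extensionality => x; rewrite memL.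
      case: ifP => [/andP[le lt]|nb].
        by rewrite setr_neq ?sb //; lia.
      rewrite /setr; case: eqP => // _.
      by rewrite /t /setl Sn nb.
    - by apply/allP => x; rewrite memL /=; lia.
    - by rewrite setr_neq ?t_lt //; lia.
  split=> [[w /(Hf _ _ _ _ _ rdy)[y Hy ->] /Hclr->]|[y Hy ->]].
    by exists y => //; rewrite -E.
  exists (setr t out y); last exact/Hclr.
  by apply/Hf => //; exists y; rewrite ?E.
split=> [[u /Hgs'[ys Hys ->] Hr]|].
  have [|y Hy ->] := (proj1 (key ys s' _)) Hr; first exact: reval_list_size Hys.
  by exists y => //; apply/reval_compE; exists ys.
case=> y /reval_compE[ys Hys Hy] ->.
exists (setl s base ys); first by apply/Hgs'; exists ys.
by apply/key; [exact: reval_list_size Hys|exists y].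
Qed.

(** At the loop head the state is [st j z], with counter [j] in [base] and accumulator [z] in [out];
    the invariant is that [z] is the value at [j]. The star may stop anywhere, but the test
    [AEq base a] accepts only when the counter equals the recursion argument. *)
Lemma comp_correct_prim f g :
  comp_correct f -> comp_correct g -> comp_correct (RPrim f g).
Proof.
move=> Hf Hg [|a args] out base s s' [s00 sb out0 /andP[out_gt0 lt_out] /andP[nin ltb]].
  split=> [[]|[y /reval_prim_nil//]].
  by rewrite sb.
move: nin ltb; rewrite inE negb_or [all _ _]/= => /andP[neq_a nin] /andP[lt_a ltb].
set v := map s args.
pose st j z := setr (setr s base j) out z.
have st0 z : st 0 z = setr s out z by rewrite /st -(sb base) // setr_id.
have st_lt j z r : r < base -> r != out -> st j z r = s r.
  by move=> lt neq; rewrite /st !setr_neq //; lia.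
have st_out j z : st j z out = z by rewrite /st setr_eq.
have st_base j z : st j z base = j by rewrite /st setr_neq ?setr_eq //; lia.
have st_gt j z r : base < r -> st j z r = 0.
  by move=> lt; rewrite /st !setr_neq ?sb //; lia.
have st_map j z : map (st j z) args = v.
  by rewrite /st !map_setr //; apply: notin_above ltb _.
have rdyf : comp_ready args out base.+2 s.
  split=> //; [by move=> r ler; apply: sb; lia|lia|].
  by rewrite nin (all_above _ _ _ ltb) //; lia.
have rdyg j z : comp_ready (base :: out :: args) base.+1 base.+2 (st j z).
  split=> //; [by rewrite st_lt //; lia|by move=> r ler; apply: st_gt; lia
    |exact: st_gt|lia|].
  rewrite !inE !negb_or (notin_above _ _ _ ltb) //= (all_above _ _ _ ltb); lia.
rewrite [compile (RPrim f g) _ _ _]/=.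
set body := PSeq (compile g _ _ _) _.
have body_sem j z u : sem body (st j z) u <->
    exists2 z', reval g (j :: z :: v) z' & u = st j.+1 z'.
  have tail z' w : sem (PSeq (pclear out) (PSeq (pcopy base.+1 out)
      (PSeq (pclear base.+1) (PAct (AInc base))))) (setr (st j z) base.+1 z') w <->
      w = st j.+1 z'.
    set u0 := setr (st j z) base.+1 z'.
    have u00 : u0 0 = 0 by rewrite /u0 setr_neq // st_lt //; lia.
    have -> : st j.+1 z' = setr (setr (setr (setr u0 out 0) out z') base.+1 0) base j.+1.
      rewrite /u0 /st; apply: functional_extensionality => x; rewrite /setr.
      by repeat case: eqP => ? //; subst; try lia; rewrite sb.
    have E1 : setr u0 out 0 base.+1 = z' by rewrite setr_neq /u0 ?setr_eq //; lia.
    split=> [[u1 /(sem_clear _ _ _ out_gt0 u00)-> [u2]]|->].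
      move/(sem_copy base.+1 out); rewrite E1 => -> //; last by rewrite setr_eq.
        case=> u3 /sem_clear-> //=; last by rewrite !setr_neq //; lia.
        move=> ->; congr setr; rewrite !setr_neq /u0 ?setr_neq ?st_base //; lia.
      by lia.
    exists (setr u0 out 0); first exact/sem_clear.
    exists (setr (setr u0 out 0) out z').
      by apply/sem_copy; rewrite ?setr_eq ?E1 //; lia.
    exists (setr (setr (setr u0 out 0) out z') base.+1 0).
      by apply/sem_clear => //; rewrite !setr_neq //; lia.
    by rewrite /=; congr setr; rewrite !setr_neq /u0 ?setr_neq ?st_base //; lia.
  split=> [[u1 /(Hg _ _ _ _ _ (rdyg j z))[z' Hz' ->] /tail->]|[z' Hz' ->]].
    by exists z' => //; move: Hz'; rewrite /= st_base st_out st_map.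
  exists (setr (st j z) base.+1 z'); last exact/tail.
  by apply/Hg => //; exists z'; rewrite //= st_base st_out st_map.
have loop_fwd u u' : rtc (sem body) u u' -> forall j z, u = st j z ->
    reval (RPrim f g) (j :: v) z ->
    exists j' z', reval (RPrim f g) (j' :: v) z' /\ u' = st j' z'.
  elim=> [x j z -> H|x y w Hxy _ IH j z E H]; first by exists j, z.
  move: Hxy; rewrite E body_sem => -[z' Hz' Ey].
  by apply: (IH _ _ Ey); apply/reval_primSE; exists z.
have loop_bwd n z : reval (RPrim f g) (n :: v) z ->
    exists2 z0, reval f v z0 & rtc (sem body) (st 0 z0) (st n z).
  elim: n z => [|n IH] z; first by move/reval_prim0E => H; exists z => //; constructor.
  case/reval_primSE=> z1 /IH[z0 Hz0 Hr] Hg1; exists z0 => //.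
  by apply: rtc_snoc Hr _; apply/body_sem; exists z.
have fin n z u : 0 < base -> sem (pclear base) (st n z) u <-> u = setr s out z.
  move=> bpos; rewrite sem_clear //; last by rewrite st_lt //; lia.
  suff -> : setr (st n z) base 0 = setr s out z by [].
  rewrite /st; apply: functional_extensionality => x; rewrite /setr.
  by repeat case: eqP => ? //; subst; try lia; rewrite sb.
have bpos : 0 < base by lia.
have st_a n z : st n z a = s a by apply: st_lt => //; rewrite eq_sym.
split=> [[u /(Hf _ _ _ _ _ rdyf)[z0 Hz0 ->]]|].
  rewrite -st0 => -[u1 /loop_fwd/(_ _ _ erefl)[|j [z [Hz ->]]]].
    exact/reval_prim0E.
  case=> u2 /= [Ej ->] /(fin _ _ _ bpos)->; exists z => //.
  by move: Ej; rewrite st_base st_a => <-.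
case=> z /= /loop_bwd[z0 Hz0 Hr] ->.
exists (setr s out z0); first by apply/Hf => //; exists z0.
exists (st (s a) z); first by rewrite -st0.
exists (st (s a) z); last exact/fin.
by rewrite /= st_base st_a.
Qed.

(** The candidate [j] is kept in [out]. An iteration goes through only if the value at [j] is
    positive, since it decrements that value; the exit requires value 0. So the accepted candidate
    is the least zero, with [f] defined below it. *)
Lemma comp_correct_mu f : comp_correct f -> comp_correct (RMu f).
Proof.
move=> Hf args out base s s' [s00 sb out0 /andP[out_gt0 lt_out] /andP[nin ltb]].
set v := map s args.
pose st j := setr s out j.
have st0 : st 0 = s by rewrite /st -out0 setr_id.
have st_ge j r : base <= r -> st j r = 0.
  by move=> le; rewrite /st setr_neq ?sb //; lia.
have st_0 j : st j 0 = 0 by rewrite /st setr_neq //; lia.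
have rdy j : comp_ready (out :: args) base base.+1 (st j).
  split=> //; [by move=> r ler; apply: st_ge; lia|exact: st_ge|lia|].
  by rewrite inE negb_or (notin_above _ _ _ ltb) //= (all_above _ _ _ ltb); lia.
have st_map j : map (st j) (out :: args) = j :: v.
  by rewrite /= {1}/st setr_eq map_setr.
have st_clr j m : setr (setr (st j) base m) base 0 = st j.
  by rewrite setr_setr -(st_ge j base) // setr_id.
rewrite [compile (RMu f) _ _ _]/=.
set body := PSeq (compile f _ _ _) (PSeq _ _).
have bpos : 0 < base by lia.
have body_sem j u : sem body (st j) u <->
    (exists m, reval f (j :: v) m.+1) /\ u = st j.+1.
  split=> [[u1 /(Hf _ _ _ _ _ (rdy j))[y Hy ->]]|[[m Hm] ->]].
    case=> u2 /= []; rewrite setr_eq => ypos -> [u3].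
    move/(proj1 (sem_clear _ _ _ bpos _)); rewrite setr_neq ?setr_neq //; try lia.
    move=> /(_ (st_0 j)); rewrite setr_setr st_clr => -> ->; split.
      by exists y.-1; rewrite (ltn_predK ypos) -st_map.
    by rewrite /st setr_eq setr_setr.
  exists (setr (st j) base m.+1); first by apply/Hf => //; exists m.+1; rewrite ?st_map.
  exists (setr (setr (st j) base m.+1) base m); first by rewrite /= setr_eq.
  exists (st j); last by rewrite /= /st setr_eq setr_setr.
  apply/sem_clear => //; last by rewrite setr_setr st_clr.
  by rewrite !setr_neq //; lia.
have loop_fwd u u' : rtc (sem body) u u' -> forall j, u = st j ->
    (forall k, k < j -> exists m, reval f (k :: v) m.+1) ->
    exists2 j', u' = st j' & forall k, k < j' -> exists m, reval f (k :: v) m.+1.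
  elim=> [x j -> H|x y w Hxy _ IH j E H]; first by exists j.
  move: Hxy; rewrite E body_sem => -[Hm Ey]; apply: (IH _ Ey) => k.
  by rewrite ltnS leq_eqVlt => /orP[/eqP->//|/H].
have loop_bwd n : (forall k, k < n -> exists m, reval f (k :: v) m.+1) ->
    rtc (sem body) s (st n).
  elim: n => [|n IH] H; first by rewrite st0; constructor.
  apply: rtc_snoc (IH _) _; first by move=> k lt; apply: H; lia.
  by apply/body_sem; split=> //; apply: H.
split=> [[u /loop_fwd/(_ 0 (esym st0))[//|j -> Hj]]|].
  case=> u1 /(Hf _ _ _ _ _ (rdy j))[y Hy ->] /= [].
  rewrite setr_eq setr_neq ?st_0; last by lia.
  move=> y0 ->; exists j.
    by apply/reval_muE; split=> //; rewrite -st_map -y0.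
  by rewrite y0 -(st_ge j base) // setr_id.
case=> n /reval_muE[Hn /loop_bwd Hr] ->.
exists (st n) => //; exists (st n).
  by apply/Hf => //; exists 0; rewrite ?st_map // -(st_ge n base) // setr_id.
by rewrite /= st_0 st_ge.
Qed.

Lemma comp_correctP f : comp_correct f.
Proof.
move: f; apply: (@recf_nested_ind comp_correct comps_correct).
- exact: comp_correct_zero.
- exact: comp_correct_succ.
- exact: comp_correct_proj.
- exact: comp_correct_comp.
- exact: comp_correct_prim.
- exact: comp_correct_mu.
- move=> args k base s s' _ _ _ _ _; apply: iff_trans (sem_skip _ _) _.
  split=> [->|[ys /reval_list_nilE-> ->]]; last by rewrite setl_nil.
  by exists [::]; [apply/reval_list_nilE|rewrite setl_nil].
- exact: comps_correct_cons.
Qed.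

(** * Programs as labelled transition systems *)

Fixpoint nlab (p : prog) : nat :=
  match p with
  | PAct _ => 0
  | PSeq p q => (nlab p + nlab q).+1
  | PStar p => (nlab p).+2
  end.

(* Transitions of [p] from label [i] to label [j]; fresh labels start at [n]. *)
Fixpoint rules (p : prog) (i j n : nat) : seq (nat * act * nat) :=
  match p with
  | PAct a => [:: (i, a, j)]
  | PSeq p q => rules p i n n.+1 ++ rules q n j (n.+1 + nlab p)
  | PStar p => [:: (i, AEq 0 0, n), (n, AEq 0 0, j), (n.+1, AEq 0 0, n)
               & rules p n n.+1 n.+2]
  end.

Definition lstep (rs : seq (nat * act * nat)) (x y : nat * state) : Prop :=
  exists2 a, List.In (x.1, a, y.1) rs & act_sem a x.2 y.2.

Lemma rules_complete p rs i j n s s' :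
  (forall x, List.In x (rules p i j n) -> List.In x rs) ->
  sem p s s' -> rtc (lstep rs) (i, s) (j, s').
Proof.
elim: p i j n s s' => [a|p IHp q IHq|p IHp] i j n s s' /= sub.
- move=> H; apply: rtc_step (rtc_refl _ _); exists a => //.
  by apply: sub; left.
- case=> u Hp Hq; apply: (@rtc_trans _ _ _ (n, u)).
    by apply: IHp Hp => x Hx; apply: sub; apply: List.in_or_app; left; exact: Hx.
  by apply: IHq Hq => x Hx; apply: sub; apply: List.in_or_app; right; exact: Hx.
- have skip l l' u : List.In (l, AEq 0 0, l') rs -> lstep rs (l, u) (l', u).
    by move=> H; exists (AEq 0 0).
  move=> H; apply: (rtc_step _ _ (n, s)); first by apply: skip; apply: sub; left.
  apply: (@rtc_snoc _ _ _ (n, s')); last by apply: skip; apply: sub; right; left.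
  elim: H => [x|x y z Hxy _ IH]; first by constructor.
  apply: rtc_trans IH; apply: (@rtc_snoc _ _ _ (n.+1, y)).
    by apply: IHp Hxy => w Hw; apply: sub; do 3 right; exact: Hw.
  by apply: skip; apply: sub; do 2 right; left.
Qed.

(** [l != l'] matters because a step will lower the flag of [l] and raise that of [l'], which is
    impossible for one register. For this reason a star has separate labels for its head and for the
    end of its body. *)
Lemma rules_labels p i j n l a l' : List.In (l, a, l') (rules p i j n) ->
  i < n -> j < n -> i != j ->
  [/\ l < n + nlab p, l' < n + nlab p & l != l'].
Proof.
elim: p i j n => [b|p IHp q IHq|p IHp] i j n /=.
- by case=> // -[<- _ <-] lti ltj neq; rewrite addn0.
- move=> /(List.in_app_or _ _ _)[/IHp|/IHq] H lti ltj neq.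
    by have [|||? ? ?] := H; try split=> //; lia.
  by have [|||? ? ?] := H; try split=> //; lia.
- case=> [[<- _ <-]|]; first by split; lia.
  case=> [[<- _ <-]|]; first by split; lia.
  case=> [[<- _ <-]|/IHp H]; first by split; lia.
  by move=> lti ltj neq; have [|||? ? ?] := H; try split=> //; lia.
Qed.

Definition rule_sound (I : nat -> state -> Prop) (x : nat * act * nat) : Prop :=
  forall s s', I x.1.1 s -> act_sem x.1.2 s s' -> I x.2 s'.

(* An assertion on the entry and exit labels that is respected by [p] extends
   to an inductive invariant on its fresh labels. *)
Lemma rules_invariant p i j n (I : nat -> state -> Prop) :
  i < n -> j < n -> i != j ->
  (forall s s', I i s -> sem p s s' -> I j s') ->
  exists2 I' : nat -> state -> Prop, (forall l, l < n -> I' l = I l) &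
    forall x, List.In x (rules p i j n) -> rule_sound I' x.
Proof.
elim: p i j n I => [a|p IHp q IHq|p IHp] i j n I lti ltj neq H /=.
- by exists I => // x [<-|//] s s'; apply: H.
(* The middle label receives the strongest postcondition of the first program. *)
- pose I1 l := if l == n then fun s => exists2 u, I i u & sem p u s else I l.
  have I1lt l : l < n -> I1 l = I l by rewrite /I1; case: eqP => //; lia.
  have I1n : I1 n = fun s => exists2 u, I i u & sem p u s by rewrite /I1 eqxx.
  have [||||I2 E2 H2] := IHp i n n.+1 I1; try lia.
    by move=> s s'; rewrite I1n I1lt // => Hi Hp; exists s.
  have [||||I3 E3 H3] := IHq n j (n.+1 + nlab p) I2; try lia.
    move=> s s'; rewrite !E2 ?I1n ?I1lt; try lia.
    by case=> u Hi Hp Hq; apply: (H u) => //; exists s.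
  exists I3; first by move=> l lt; rewrite E3 ?E2 ?I1lt //; lia.
  move=> [[l a] l'] /(List.in_app_or _ _ _)[Hx|]; last exact: H3.
  have [|||? ? _] := rules_labels _ _ _ _ _ _ _ Hx; try lia.
  by move: (H2 _ Hx); rewrite /rule_sound /= !E3.
(* Head and end of the body share the loop invariant: reachable from an entry state by iterating the
   body. *)
- pose I1 l := if (l == n) || (l == n.+1)
    then fun s => exists2 u, I i u & rtc (sem p) u s else I l.
  have I1lt l : l < n -> I1 l = I l.
    by rewrite /I1; case: orP => // -[] /eqP; lia.
  have I1n : I1 n = fun s => exists2 u, I i u & rtc (sem p) u s by rewrite /I1 eqxx.
  have I1n1 : I1 n.+1 = fun s => exists2 u, I i u & rtc (sem p) u s.
    by rewrite /I1 eqxx orbT.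
  have [||||I2 E2 H2] := IHp n n.+1 n.+2 I1; try lia.
    by move=> s s'; rewrite I1n I1n1 => -[u Hi Hr] Hp; exists u => //; apply: rtc_snoc Hr Hp.
  exists I2; first by move=> l lt; rewrite E2 ?I1lt //; lia.
  have [lt1 lt2 lt3 lt4] : [/\ n < n.+2, n.+1 < n.+2, i < n.+2 & j < n.+2].
    by split; lia.
  move=> x [<-|[<-|[<-|]]]; last exact: H2.
  + move=> s s' /=; rewrite !E2 ?I1n ?I1lt // => Hi [_ ->].
    by exists s => //; constructor.
  + move=> s s' /=; rewrite !E2 ?I1n ?I1lt // => -[u Hi Hr] [_ ->].
    exact: H Hi Hr.
  + by move=> s s' /=; rewrite !E2 ?I1n ?I1n1 // => Hi [_ ->].
Qed.

Lemma rules_correct p s s' :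
  rtc (lstep (rules p 0 1 2)) (0, s) (1, s') <-> sem p s s'.
Proof.
split=> [H|]; last exact: (@rules_complete _ _ _ _ 2).
(* [False] is a placeholder: [rules_invariant] keeps the assertions at the labels 0 and 1 and
   supplies the others. *)
pose I l u := if l == 0 then u = s else if l == 1 then sem p s u else False.
have [||||I' E Hs] := rules_invariant p 0 1 2 I => //.
  by move=> u u' ->.
have inv x y : rtc (lstep (rules p 0 1 2)) x y -> I' x.1 x.2 -> I' y.1 y.2.
  elim=> // {}x u {}y [a Hin Ha] _ IH Hx; apply: IH.
  exact: Hs _ Hin _ _ Hx Ha.
by have := inv _ _ H; rewrite /= !E //=; apply.
Qed.

(** * Counter systems *)

Inductive delta : Type := DSame | DInc | DDec.

Definition drel (d : delta) (x y : nat) : Prop :=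
  match d with DSame => y = x | DInc => y = x.+1 | DDec => x = y.+1 end.

(** Rules carry no labels: control sits in flag registers, so a configuration is a single vector of
    numbers. [DDec] doubles as a positivity test. *)
Record vrule : Type := VRule { change : nat -> delta; guards : seq (nat * nat) }.

Definition vstep (v : vrule) (c c' : state) : Prop :=
  (forall r, drel (change v r) (c r) (c' r)) /\
  (forall g, List.In g (guards v) -> c g.1 = c g.2).

Definition vrun (rs : seq vrule) (c0 : state) (fin : nat) : Prop :=
  exists (T : nat) (c : nat -> state),
    [/\ c 0 = c0,
        forall t, t < T -> exists2 v, List.In v rs & vstep v (c t) (c t.+1)
      & 0 < c T fin].

Definition vbounded (m : nat) (v : vrule) : Prop :=
  (forall r, m <= r -> change v r = DSame) /\
  (forall g, List.In g (guards v) -> g.1 < m /\ g.2 < m).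

(* Data register [r] becomes register [2r]; register [2l+1] flags label [l]. *)
Definition enc (x : nat * state) : state :=
  fun r => if odd r then (r./2 == x.1 : nat) else x.2 r./2.

Definition vrule_of (x : nat * act * nat) : vrule :=
  VRule
    (fun r => if odd r
       then if r./2 == x.1.1 then DDec else if r./2 == x.2 then DInc else DSame
       else match x.1.2 with
            | AInc q => if r./2 == q then DInc else DSame
            | ADec q => if r./2 == q then DDec else DSame
            | AEq _ _ => DSame
            end)
    (match x.1.2 with AEq q q' => [:: (q.*2, q'.*2)] | _ => [::] end).

Lemma vstep_enc i a j x c : i != j ->
  vstep (vrule_of (i, a, j)) (enc x) c <->
  x.1 = i /\ exists2 s, act_sem a x.2 s & c = enc (j, s).
Proof.
case: x => l s neq; split.
  case=> /= Hc Hg.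
  (* The rule lowers the flag of [i], so that flag is positive, and only the flag of the current
     label is. *)
  have El : l = i.
    have := Hc i.*2.+1; rewrite /enc /= odd_double /= uphalf_double eqxx /=.
    by case: eqP.
  split=> //; subst l; exists (fun r => c r.*2); last first.
    apply: functional_extensionality => r; rewrite /enc /=.
    have := odd_double_half r; have := Hc r; rewrite /enc /=.
    case: (odd r) => /=; last by rewrite add0n => _ ->.
    case: eqP => [->|ni]; first by rewrite (negPf neq) => -[].
    by case: eqP.
  have data r : drel (match a with
      | AInc q => if r == q then DInc else DSame
      | ADec q => if r == q then DDec else DSame
      | AEq _ _ => DSame end) (s r) (c r.*2).
    by have := Hc r.*2; rewrite /enc /= odd_double doubleK.
  case: a Hc Hg data => [q|q|q q'] _ Hg data /=.
  + apply: functional_extensionality => r; rewrite /setr.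
    by have := data r; case: eqP => [->|].
  + split; first by have := data q; rewrite eqxx /= => ->.
    apply: functional_extensionality => r; rewrite /setr.
    by have := data r; case: eqP => [->|//] /= ->.
  + split; first by have := Hg _ (or_introl erefl); rewrite /enc /= !odd_double !doubleK.
    by apply: functional_extensionality => r; apply: data.
case=> /= El [s' Ha ->]; subst i; split=> [r|g]; rewrite /enc /=.
  case: ifP => _.
    case: eqP => [->|_]; first by case: eqP => // E; rewrite E eqxx in neq.
    by case: eqP.
  case: a Ha => [q|q|q q'] /=.
  + by move=> ->; rewrite /setr; case: eqP => [->|].
  + by case=> pos ->; rewrite /setr; case: eqP => [->|//] /=; lia.
  + by case=> _ ->.
case: a Ha => [q|q|q q'] //= [E _] [<-|//] /=.
by rewrite !odd_double !doubleK.
Qed.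

Lemma rtc_seqP T (R : T -> T -> Prop) x y :
  rtc R x y <-> exists (n : nat) (c : nat -> T),
    [/\ c 0 = x, forall t, t < n -> R (c t) (c t.+1) & c n = y].
Proof.
split.
  elim=> [z|x' u z Hxu _ [n [c [c0 Hc cn]]]]; first by exists 0, (fun=> z).
  exists n.+1, (fun t => if t is t'.+1 then c t' else x'); split=> //.
  by case=> [|t] lt; [rewrite c0|apply: Hc].
case=> n [c [<- Hc <-]]; elim: n Hc => [|n IH] Hc; first by constructor.
by apply: rtc_snoc (IH _) (Hc _ _) => // t lt; apply: Hc; lia.
Qed.

(** Register 3 is the flag of the exit label 1, so a positive value there means that the program has
    terminated. *)
Lemma vrun_rules p s :
  vrun (map vrule_of (rules p 0 1 2)) (enc (0, s)) 3 <-> exists s', sem p s s'.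
Proof.
set rs := rules p 0 1 2.
have neq l a l' : List.In (l, a, l') rs -> l != l'.
  by move=> /rules_labels[] .
split.
  case=> T [c [c0 Hc fin]].
  have inv t : t <= T -> exists2 x, rtc (lstep rs) (0, s) x & c t = enc x.
    elim: t => [|t IH] le; first by exists (0, s) => //; constructor.
    have [x Hx Ex] := IH (ltnW le).
    have [v /List.in_map_iff[[[i a] j] [<- Hin]]] := Hc t le.
    rewrite Ex => /vstep_enc[|El [s' Hs' ->]]; first exact: neq Hin.
    by exists (j, s') => //; apply: rtc_snoc Hx _; exists a; rewrite ?El.
  have [[l s'] Hx Ex] := inv T (leqnn T).
  move: fin; rewrite Ex /enc /=; case: eqP => // El _.
  have {}El : l = 1 by rewrite -El.
  by exists s'; apply/rules_correct; rewrite El in Hx.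
case=> s' /rules_correct/rtc_seqP[T [x [x0 Hx xT]]].
exists T, (fun t => enc (x t)); split; [by rewrite x0| |by rewrite xT].
move=> t lt; have [a Hin Ha] := Hx t lt.
exists (vrule_of ((x t).1, a, (x t.+1).1)); first exact: List.in_map.
apply/vstep_enc; first exact: neq Hin.
by split=> //; exists (x t.+1).2 => //; case: (x t.+1).
Qed.

Definition act_bound (a : act) : nat :=
  match a with AInc q => q | ADec q => q | AEq q q' => q + q' end.

(** Finitely many rules touch finitely many registers; [3 < m] keeps the accepting flag among the
    stored ones. *)
Lemma vbounded_rules (L : seq (nat * act * nat)) :
  exists2 m, 3 < m & forall v, List.In v (map vrule_of L) -> vbounded m v.
Proof.
elim: L => [|[[i a] j] L [m m3 Hm]]; first by exists 4.
exists (m + (i + j + act_bound a).+1.*2); first by lia.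
move=> v [<-|Hin].
  split=> [r le|g] /=.
    have := odd_double_half r; case: (odd r) => /= E.
      by case: eqP => [|_]; first lia; case: eqP => //; lia.
    by case: a le => [q|q|q q'] //= le; case: eqP => //; lia.
  by case: a => [q|q|q q'] //= [<-|//] /=; lia.
have [H1 H2] := Hm _ Hin; split=> [r le|g /H2 []]; last by lia.
by apply: H1; lia.
Qed.

(** * Partitions as row-length functions *)

Definition pr (p : partition) (a : nat) : nat := nth 0 (parts p) a.

Lemma pr_mono p a b : a <= b -> pr p b <= pr p a.
Proof.
move=> le; have /andP[srt _] := partsP p.
have [ltb|geb] := ltnP b (size (parts p)); last by rewrite /pr nth_default.
have geqT : transitive geq by move=> x y z /= H1 H2; apply: leq_trans H2 H1.
by apply: (sorted_leq_nth geqT (fun x => leqnn x) 0 srt) => //; apply: leq_ltn_trans ltb.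
Qed.

(** The condition on sizes follows from the row lengths: a row of [p] beyond the end of [q] would be
    positive yet at most the default 0. *)
Lemma young_leP p q : young_le p q <-> forall a, pr p a <= pr q a.
Proof.
split=> [[sz H] a|H].
  have [lt|ge] := ltnP a (size (parts p)); first exact: H.
  by rewrite /pr nth_default.
split=> [|i _]; last exact: H.
have [//|lt] := leqP (size (parts p)) (size (parts q)).
have /andP[_ /allP pos] := partsP p.
have := H (size (parts q)); rewrite /pr [X in _ <= X]nth_default // leqn0.
by have /pos := mem_nth 0 lt; case: nth.
Qed.

Lemma young_le_refl p : young_le p p.
Proof. exact/young_leP. Qed.

Lemma is_partition_sort s : is_partition (sort geq (filter (ltn 0) s)).
Proof.
apply/andP; split; first by apply: sort_sorted => x y /=; apply: leq_total.
by rewrite all_sort filter_all.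
Qed.

(* Sorting only serves to make [mkpart] total: see [pr_mkpart]. *)
Definition mkpart (n : nat) (f : nat -> nat) : partition :=
  Partition (is_partition_sort (mkseq f n)).

Lemma nth_filter_pos s a : sorted geq s -> nth 0 (filter (ltn 0) s) a = nth 0 s a.
Proof.
elim: s a => [|x s IH] a //= srt; have srt' := path_sorted srt.
case: ltnP => [_|x0]; first by case: a => //= a; apply: IH.
have {}x0 : x = 0 by lia.
subst x; have geqT : transitive geq by move=> y z w /= H1 H2; apply: leq_trans H2 H1.
have /allP s0 := order_path_min geqT srt.
have -> : filter (ltn 0) s = [::].
  by apply/eqP; rewrite -[_ == _]negbK -has_filter; apply/hasPn => y /s0 /=; lia.
rewrite nth_nil; case: a => //= a.
have [lt|ge] := ltnP a (size s); last by rewrite nth_default.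
by have /= := s0 _ (mem_nth 0 lt); lia.
Qed.

Lemma nonincr_le (f : nat -> nat) : (forall a, f a.+1 <= f a) ->
  forall a b, a <= b -> f b <= f a.
Proof.
move=> H a b le; rewrite -(subnKC le); elim: (b - a) => [|d IH]; first by rewrite addn0.
by rewrite addnS; apply: leq_trans IH.
Qed.

(** Here the list is already sorted, and filtering removes only trailing zeros, which the default of
    [nth] restores. *)
Lemma pr_mkpart n f : (forall a, f a.+1 <= f a) -> f n = 0 ->
  forall a, pr (mkpart n f) a = f a.
Proof.
move=> H f0 a; have mono := nonincr_le f H.
have srt : sorted geq (mkseq f n).
  apply/(sortedP 0) => i; rewrite size_mkseq => lt.
  by rewrite !nth_mkseq //=; lia.
have geqT : transitive geq by move=> y z w /= H1 H2; apply: leq_trans H2 H1.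
rewrite /pr /= sorted_sort //; last exact: sorted_filter.
rewrite nth_filter_pos //; have [lt|ge] := ltnP a n; first by rewrite nth_mkseq.
by rewrite nth_default ?size_mkseq //; have := mono _ _ ge; lia.
Qed.

(** * Rows, columns and rectangles described by the order and the constant *)

Definition rect (a b : nat) : partition := mkpart a (fun x => if x < a then b else 0).

Lemma pr_rect a b x : pr (rect a b) x = if x < a then b else 0.
Proof. by rewrite pr_mkpart ?ltnn // => y; case: ifP; case: ifP => //; lia. Qed.

Lemma pr_part11 x : pr part11 x = (x < 2).
Proof. by case: x => [|[|x]] //; rewrite /pr /= nth_nil. Qed.

Lemma part11_le p : young_le part11 p <-> 0 < pr p 1.
Proof.
rewrite young_leP; split=> [/(_ 1)|H a]; first by rewrite pr_part11.
rewrite pr_part11; case: ltnP => // lt.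
by apply: leq_trans H _; apply: pr_mono; lia.
Qed.

Lemma rowP p : ~ young_le part11 p <-> pr p 1 = 0.
Proof. by rewrite part11_le; split; lia. Qed.

Lemma pr_row p : pr p 1 = 0 -> forall x, pr p x = if x == 0 then pr p 0 else 0.
Proof. by move=> H [|x] //=; have := pr_mono p 1 x.+1; lia. Qed.

Lemma row_le p q : pr p 1 = 0 -> young_le p q <-> pr p 0 <= pr q 0.
Proof.
move=> row; rewrite young_leP; split=> [/(_ 0)//|H a].
by rewrite pr_row //; case: eqP => // ->.
Qed.

Lemma pr_row1 n : pr (rect 1 n) 1 = 0.
Proof. by rewrite pr_rect. Qed.

Lemma pr_row0 n : pr (rect 1 n) 0 = n.
Proof. by rewrite pr_rect. Qed.

(* With [s] the partition (2), a partition is a column iff it is not above [s]. *)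
Definition is_two (s : partition) : Prop :=
  [/\ ~ young_le part11 s, ~ young_le s part11
    & forall Z, young_le part11 Z \/ young_le s Z \/ young_le Z part11].

Lemma is_two_rect : is_two (rect 1 2).
Proof.
split; first by rewrite rowP pr_row1.
  by rewrite row_le ?pr_row1 // pr_row0 pr_part11.
move=> Z; have [|] := ltnP 0 (pr Z 1); first by rewrite -part11_le; left.
move=> row; right; rewrite !row_le ?pr_row1 ?pr_row0 ?pr_part11; lia.
Qed.

(** [s] is a row not below (1,1), hence of length at least 2; the instance [Z = (2)] of the last
    clause of [is_two] bounds it by 2. *)
Lemma two_le s X : is_two s -> young_le s X <-> 1 < pr X 0.
Proof.
case=> [/rowP row le /(_ (rect 1 2)) H].
have lt : 1 < pr s 0 by move: le; rewrite row_le // pr_part11 /=; lia.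
have : pr s 0 <= 2.
  move: H; rewrite part11_le !row_le ?pr_row1 // !pr_row0 pr_part11 /=; lia.
by rewrite row_le //; lia.
Qed.

Definition is_col (C : partition) (h : nat) : Prop := forall x, pr C x = (x < h).

Lemma col_exists C : pr C 0 <= 1 -> exists h, is_col C h.
Proof.
move=> le1; exists (size (parts C)) => x; have /andP[_ /allP pos] := partsP C.
have [lt|ge] := ltnP x (size (parts C)); last by rewrite /pr nth_default.
by move: le1 (pos _ (mem_nth 0 lt)) (pr_mono C 0 x (leq0n _)); rewrite /pr /=; lia.
Qed.

Lemma col_rect h : is_col (rect h 1) h.
Proof. by move=> x; rewrite pr_rect; case: ltnP. Qed.

Lemma col_le C h X : is_col C h.+1 -> young_le C X <-> 0 < pr X h.
Proof.
move=> col; rewrite young_leP; split=> [/(_ h)|H a]; first by rewrite col leqnn.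
rewrite col; case: ltnP => // lt.
by apply: leq_trans H _; apply: pr_mono; lia.
Qed.

(** [C'] is a column taller than [C]. Taking for [W] the column of height [h.+1], which is neither
    wide nor below [C], forces [C'] below it. *)
Lemma col_succ s C C' h : is_two s -> is_col C h -> ~ young_le s C' ->
  ~ young_le C' C -> (forall W, young_le s W \/ young_le W C \/ young_le C' W) ->
  is_col C' h.+1.
Proof.
move=> two col; rewrite (two_le _ _ two) => le1 nle /(_ (rect h.+1 1)).
have [|h' col'] := col_exists C'; first by lia.
rewrite (two_le _ _ two) (col_le _ _ _ (col_rect _)) pr_rect col /= ltnn.
case: h' col' => [|h'] col' H.
  by case: nle; apply/young_leP => a; rewrite col'.
move: nle H; rewrite !(col_le _ _ _ col') col pr_rect => nle H.
suff -> : h = h' by [].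
have le : h <= h' by apply: contra_notT nle; rewrite -ltnNge => ->.
have lth : h' < h.+1 by apply: contraPT H => /negPf->; rewrite ltnn => -[|[]].
by lia.
Qed.

Lemma col_succ_rect s h W : is_two s ->
  young_le s W \/ young_le W (rect h 1) \/ young_le (rect h.+1 1) W.
Proof.
move=> two; rewrite (two_le _ _ two) (col_le _ _ _ (col_rect _)).
have [|le1] := ltnP 1 (pr W 0); first by left.
right; have [|le0] := ltnP 0 (pr W h); first by right.
left; apply/young_leP => a; rewrite col_rect; case: ltnP => lt.
  by apply: leq_trans le1; apply: pr_mono.
by have := pr_mono W _ _ lt; lia.
Qed.

Lemma row_succ D D' : pr D 1 = 0 -> ~ young_le part11 D' -> ~ young_le D' D ->
  (forall W, young_le part11 W \/ young_le W D \/ young_le D' W) ->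
  pr D' 1 = 0 /\ pr D' 0 = (pr D 0).+1.
Proof.
move=> row /rowP row' nle /(_ (rect 1 (pr D 0).+1)) H; split=> //.
move: nle H; rewrite part11_le !row_le ?pr_row1 // pr_row0; lia.
Qed.

Lemma row_succ_rect n W :
  young_le part11 W \/ young_le W (rect 1 n) \/ young_le (rect 1 n.+1) W.
Proof.
have [|row] := ltnP 0 (pr W 1); first by rewrite -part11_le; left.
by right; rewrite !row_le ?pr_row1 ?pr_row0 //; lia.
Qed.

(** [R] is the largest partition with at most [h.+1] rows and first row shorter than [D], that is, a
    rectangle. Such a rectangle lies below [X] exactly when its last row, of index [h], fits into
    row [h] of [X]. *)
Lemma rect_le R C D h : is_col C h.+2 -> pr D 1 = 0 ->
  (forall W, young_le W R <-> ~ young_le C W /\ ~ young_le D W) ->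
  0 < pr D 0 /\ forall X, young_le R X <-> (pr D 0).-1 <= pr X h.
Proof.
move=> col row H.
have H' W : young_le W R <-> pr W h.+1 = 0 /\ pr W 0 < pr D 0.
  by rewrite H (col_le _ _ _ col) row_le //; split; lia.
have [R0 ltR] := proj1 (H' R) (young_le_refl R).
split=> [|X]; first by lia.
split=> [/young_leP/(_ h) le|le].
  have : young_le (rect h.+1 (pr D 0).-1) R by rewrite H' !pr_rect ltnn /=; lia.
  by move/young_leP/(_ h); rewrite pr_rect leqnn => le'; apply: leq_trans le.
apply/young_leP => a; have [lea|lta] := leqP a h.
  by have := pr_mono R _ _ (leq0n a); have := pr_mono X _ _ lea; lia.
by have := pr_mono R _ _ lta; lia.
Qed.

Lemma rect_char h b W :
  young_le W (rect h.+1 b) <->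
  ~ young_le (rect h.+2 1) W /\ ~ young_le (rect 1 b.+1) W.
Proof.
rewrite (col_le _ _ _ (col_rect _)) (row_le _ _ (pr_row1 _)) pr_row0 young_leP.
split=> [H|[H1 H2] a].
  by have := H h.+1; have := H 0; rewrite !pr_rect ltnn /=; lia.
rewrite pr_rect; case: ltnP => lt; first by have := pr_mono W _ _ (leq0n a); lia.
by have := pr_mono W _ _ lt; lia.
Qed.

(** * Runs of counter systems as tuples of partitions *)

(* A run of length [T] is stored in the partitions [z] and [p r], with
   [T + 1] rows: row [t] of [z] is [T - t + 1], and row [t] of [p r] exceeds it
   by the value of register [r] at time [t].  The slope of [z] keeps the rows
   of [p r] nonincreasing, since a register grows by at most one per step. *)

(** [two_sem] and the later [_sem] predicates are stripped of their quantifier over [Z] or [W], so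
    that quantifier-free formulas can mirror them; [two_sem s Z] for all [Z] is [is_two s]. *)
Definition two_sem (s Z : partition) : Prop :=
  [/\ ~ young_le part11 s, ~ young_le s part11
    & young_le part11 Z \/ young_le s Z \/ young_le Z part11].

Definition row_succ_sem (W D D' : partition) : Prop :=
  [/\ ~ young_le part11 D', ~ young_le D' D
    & young_le part11 W \/ young_le W D \/ young_le D' W].

Definition col_succ_sem (s W C C' : partition) : Prop :=
  [/\ ~ young_le s C', ~ young_le C' C
    & young_le s W \/ young_le W C \/ young_le C' W].

Definition rect_sem (W R C D : partition) : Prop :=
  young_le W R <-> ~ young_le C W /\ ~ young_le D W.

(** The input [k] is expressed by [k] successors of [y 0], to which [matrix_sem] gives the length of
    the first row of [z]. No other clause of the matrix mentions [k], as the diagonal argument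
    requires. *)
Definition chain_sem (k : nat) (x : partition) (y : nat -> partition) (Z : partition) : Prop :=
  x = y k /\ forall i, i < k -> row_succ_sem Z (y i) (y i.+1).

(* Register 2 is the input, register 1 the flag of the initial label. *)
Definition start (x : partition) (y : nat -> partition) (r : nat) : partition :=
  if r == 2 then x else y (r == 1).

Definition first_row_sem (Z q q' : partition) : Prop :=
  young_le part11 Z \/ (young_le Z q <-> young_le Z q').

(** The middle clause says that columns below [p r] lie below [z]; with [z] below [p r], both have
    the same number of rows. *)
Definition regs_sem (m : nat) (p : nat -> partition) (z s x : partition)
    (y : nat -> partition) (Z : partition) : Prop :=
  forall r, r < m ->
  [/\ young_le z (p r),
      young_le s Z \/ ~ young_le Z (p r) \/ young_le Z z
    & first_row_sem Z (p r) (start x y r)].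

(** Time [t] is named by the column [C] of height [t + 2], reaching down to row [t + 1]. That [C]
    lies below [z] ensures that this next row exists. *)
Definition time_sem (s z C C' W : partition) : Prop :=
  [/\ ~ young_le s C, young_le part11 C, young_le C z & col_succ_sem s W C C'].

(* [d 0], [d 1], [d 2] are consecutive rows; [d 3], .., [d 6] are the
   rectangles bounded by [C] or [C'] and these rows. *)
Definition cell_sem (C C' W : partition) (d : nat -> partition) : Prop :=
  [/\ ~ young_le part11 (d 0),
      row_succ_sem W (d 0) (d 1) /\ row_succ_sem W (d 1) (d 2),
      rect_sem W (d 3) C (d 0), rect_sem W (d 4) C' (d 0)
    & rect_sem W (d 5) C (d 1) /\ rect_sem W (d 6) C (d 2)].

(** Over all widths [b], the equivalences say that row [t] of [q] exceeds row [t + 1] by 1, 0 or 2.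
    The shift by 1 for [DSame] is the slope of [z]. *)
Definition change_sem (e : delta) (q : partition) (d : nat -> partition) : Prop :=
  match e with
  | DSame => young_le (d 5) q <-> young_le (d 4) q
  | DInc => young_le (d 3) q <-> young_le (d 4) q
  | DDec => young_le (d 6) q <-> young_le (d 4) q
  end.

Definition rule_sem (v : vrule) (m : nat) (p : nat -> partition) (z : partition)
    (d : nat -> partition) : Prop :=
  [/\ change_sem DSame z d,
      forall r, r < m -> change_sem (change v r) (p r) d
    & forall j, j < size (guards v) ->
      (young_le (d 3) (p (nth (0, 0) (guards v) j).1) <->
       young_le (d 3) (p (nth (0, 0) (guards v) j).2))].

Definition idle : vrule := VRule (fun=> DSame) [::].

(** Prenex form of an implication: if [C], [C'] and the cells pass their tests for all [W], some
    rule applies. The premises are negated, so [W] becomes existential. Every rule [i] has its own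
    cells [d i]; see [finite_choice]. *)
Definition step_sem (rs : seq vrule) (m : nat) (p : nat -> partition)
    (z s C C' : partition) (d : nat -> nat -> partition) (W : partition) : Prop :=
  ~ time_sem s z C C' W \/
  exists2 i, i < size rs &
    ~ cell_sem C C' W (d i) \/ rule_sem (nth idle rs i) m p z (d i).

Definition matrix_sem (rs : seq vrule) (m k : nat) (p : nat -> partition)
    (z s x : partition) (y : nat -> partition)
    (Z C C' : partition) (d : nat -> nat -> partition) (W : partition) : Prop :=
  chain_sem k x y Z /\
  [/\ two_sem s Z, ~ young_le part11 (y 0) /\ first_row_sem Z z (y 0),
      regs_sem m p z s x y Z, ~ young_le (p 3) z & step_sem rs m p z s C C' d W].

Lemma In_nth T (x0 x : T) (l : seq T) :
  List.In x l <-> exists2 i, i < size l & nth x0 l i = x.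
Proof.
elim: l => [|y l IH] /=; first by split=> // -[].
split=> [[->|/IH[i lt <-]]|[[|i] lt E]]; [by exists 0|by exists i.+1|by left|].
by right; apply/IH; exists i.
Qed.

(** * Numerical meaning of the predicates *)

Lemma time_num s z C C' : is_two s -> (forall W, time_sem s z C C' W) ->
  exists t, [/\ is_col C t.+2, is_col C' t.+3 & 0 < pr z t.+1].
Proof.
move=> two H; have [le1 /part11_le gt0 lez _] := H part11.
have [|h col] := col_exists C; first by move: le1; rewrite (two_le _ _ two); lia.
case: h col => [|[|t]] col; [by move: gt0; rewrite col..|].
exists t; split=> //; last by move: lez; rewrite (col_le _ _ _ col).
have [_ _ _ [nle nle' _]] := H part11.
by apply: (@col_succ s C) => // W; have [_ _ _ []] := H W.
Qed.

(** The rows [d 0], [d 1], [d 2] have lengths [b + 1], [b + 2], [b + 3]: a rectangle is one cell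
    narrower than the row that bounds it. *)
Lemma cell_num t C C' d : is_col C t.+2 -> is_col C' t.+3 ->
  (forall W, cell_sem C C' W d) -> forall b, b = (pr (d 0) 0).-1 -> forall X,
  [/\ young_le (d 3) X <-> b <= pr X t, young_le (d 4) X <-> b <= pr X t.+1,
      young_le (d 5) X <-> b.+1 <= pr X t & young_le (d 6) X <-> b.+2 <= pr X t].
Proof.
move=> col col' H.
have [/rowP row0 [[a1 a2 _] [b1 b2 _]] _ _ _] := H part11.
have [row1 E1] : pr (d 1) 1 = 0 /\ pr (d 1) 0 = (pr (d 0) 0).+1.
  by apply: row_succ => // W; have [_ [[]]] := H W.
have [row2 E2] : pr (d 2) 1 = 0 /\ pr (d 2) 0 = (pr (d 1) 0).+1.
  by apply: row_succ => // W; have [_ [_ []]] := H W.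
have [|pos H3] := @rect_le (d 3) C (d 0) t col row0.
  by move=> W; have [] := H W.
have [|_ H4] := @rect_le (d 4) C' (d 0) t.+1 col' row0.
  by move=> W; have [] := H W.
have [|_ H5] := @rect_le (d 5) C (d 1) t col row1.
  by move=> W; have [_ _ _ _ []] := H W.
have [|_ H6] := @rect_le (d 6) C (d 2) t col row2.
  by move=> W; have [_ _ _ _ []] := H W.
move=> b -> X; split; [exact: H3|exact: H4| |].
  by rewrite H5 E1; lia.
by rewrite H6 E2 E1; lia.
Qed.

Definition cells (t b : nat) (o : nat) : partition :=
  match o with
  | 0 => rect 1 b.+1 | 1 => rect 1 b.+2 | 2 => rect 1 b.+3
  | 3 => rect t.+1 b | 4 => rect t.+2 b | 5 => rect t.+1 b.+1
  | _ => rect t.+1 b.+2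
  end.

Lemma row_succ_sem_rect W n : row_succ_sem W (rect 1 n) (rect 1 n.+1).
Proof.
split; [by rewrite rowP pr_row1| |exact: row_succ_rect].
by rewrite row_le ?pr_row1 // !pr_row0; lia.
Qed.

Lemma cells_sem t b W : cell_sem (rect t.+2 1) (rect t.+3 1) W (cells t b).
Proof.
split=> /=; [by rewrite rowP pr_row1|by split; apply: row_succ_sem_rect
  |exact: rect_char|exact: rect_char|by split; apply: rect_char].
Qed.

Lemma cells_time s z t W : is_two s -> 0 < pr z t.+1 ->
  time_sem s z (rect t.+2 1) (rect t.+3 1) W.
Proof.
move=> two pos; split; last split.
- by rewrite (two_le _ _ two) pr_rect.
- by rewrite part11_le pr_rect.
- exact/(col_le _ _ _ (col_rect _)).
- by rewrite (two_le _ _ two) pr_rect.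
- by rewrite (col_le _ _ _ (col_rect _)) pr_rect ltnn.
- exact: col_succ_rect.
Qed.

(** If every [P i] failed somewhere, one [b] collecting the counterexamples would violate the
    hypothesis. Applied to independent widths for the rules, it yields one rule that passes at every
    width. *)
Lemma finite_choice N (P : nat -> nat -> Prop) :
  (forall b : nat -> nat, exists2 i, i < N & P i (b i)) ->
  exists2 i, i < N & forall c, P i c.
Proof.
elim: N P => [|N IH] P H; first by have [] := H (fun=> 0).
have [HN|/not_all_ex_not[c nP]] := classic (forall c, P N c); first by exists N.
have [|i lt Hi] := IH P; last by exists i => //; apply: ltnW.
move=> b; have [i] := H (fun i => if i == N then c else b i).
rewrite ltnS leq_eqVlt => /orP[/eqP->|lt]; first by rewrite eqxx.
by rewrite ltn_eqF // => Hi; exists i.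
Qed.

Definition init (k : nat) : state := enc (0, setr (fun=> 0) 1 k).

Lemma initE k r : init k r = if r == 2 then k else (r == 1).
Proof.
rewrite /init /enc /setr /=; have := odd_double_half r.
case: (odd r) => /= E; first by repeat case: eqP => //; lia.
by repeat case: eqP => //; lia.
Qed.

Lemma first_rowP q q' : pr q' 1 = 0 ->
  (forall Z, first_row_sem Z q q') <-> pr q 0 = pr q' 0.
Proof.
move=> row; split=> [H|E Z].
  have key n : n <= pr q 0 <-> n <= pr q' 0.
    by move: (H (rect 1 n)); rewrite /first_row_sem part11_le !row_le ?pr_row1 // pr_row0; case.
  by apply/eqP; rewrite eqn_leq; apply/andP; split; apply/key.
have [|rowZ] := ltnP 0 (pr Z 1); first by rewrite -part11_le; left.
by right; rewrite !row_le ?E //; lia.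
Qed.

Lemma change_num e q d t b :
  (forall X,
   [/\ young_le (d 3) X <-> b <= pr X t, young_le (d 4) X <-> b <= pr X t.+1,
       young_le (d 5) X <-> b.+1 <= pr X t & young_le (d 6) X <-> b.+2 <= pr X t]) ->
  change_sem e q d <->
  (match e with DSame => b.+1 | DInc => b | DDec => b.+2 end <= pr q t <->
   b <= pr q t.+1).
Proof. by move=> /(_ q)[H3 H4 H5 H6]; case: e; rewrite /= ?H3 ?H4 ?H5 ?H6. Qed.

(** * Equivalence between runs and tuples of partitions *)

(** If [C], [C'] or the cells of the applied rule fail a test, a failing [W] is the witness;
    otherwise the rule applied at time [t] satisfies its clause, whatever [W] is. *)
Lemma matrix_sem_of_vrun rs m k :
  vrun rs (init k) 3 ->
  exists p z s x y, forall Z C C' d, exists W,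
    matrix_sem rs m k p z s x y Z C C' d W.
Proof.
move=> [T [c [c0 Hc fin]]].
pose zf t := if t <= T then (T - t).+1 else 0.
pose f r t := if t <= T then (T - t).+1 + c t r else 0.
pose z := mkpart T.+1 zf; pose p r := mkpart T.+1 (f r).
pose y i := rect 1 (T.+1 + i).
have zE t : pr z t = zf t.
  apply: pr_mkpart => [a|]; rewrite /zf ?ltnn //.
  by case: ifP; case: ifP => //; lia.
have grow r t : t < T -> c t.+1 r <= (c t r).+1.
  by move=> /Hc[v _ [/(_ r)]]; case: (change v r) => /=; lia.
have pE r t : pr (p r) t = f r t.
  apply: pr_mkpart => [a|]; rewrite /f ?ltnn //.
  case: ifP; case: ifP => //; try lia.
  by move=> _ lt; have := grow r a lt; lia.
have two := is_two_rect.
have stat Z : [/\ chain_sem k (y k) y Z, two_sem (rect 1 2) Z,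
    ~ young_le part11 (y 0) /\ first_row_sem Z z (y 0),
    regs_sem m p z (rect 1 2) (y k) y Z & ~ young_le (p 3) z].
  split.
  - by split=> // i _; rewrite /y addnS; apply: row_succ_sem_rect.
  - by case: two => ? ? /(_ Z).
  - split; first by rewrite rowP pr_row1.
    apply: (proj2 (first_rowP _ _ _)); rewrite ?pr_row1 //.
    by rewrite zE pr_row0 /zf leq0n; lia.
  - move=> r _; split.
    + by apply/young_leP => a; rewrite zE pE /zf /f; case: ifP => //; lia.
    + have [|le1] := ltnP 1 (pr Z 0); first by rewrite -(two_le _ _ two); left.
      right; have [[|h] col] := col_exists Z le1.
        by right; apply/young_leP => a; rewrite col.
      rewrite !(col_le _ _ _ col) zE pE /zf /f; case: ifP => _; [right|left]; lia.
    + apply: (proj2 (first_rowP _ _ _)); rewrite /start.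
        by case: ifP; rewrite pr_row1.
      rewrite pE /f leq0n c0 initE.
      by case: ifP => _; rewrite pr_row0; lia.
  (* Acceptance at time [T] is visible as the excess of [p 3] over [z] in row [T]. *)
  - by move=> /young_leP/(_ T); rewrite pE zE /f /zf leqnn; lia.
exists p, z, (rect 1 2), (y k), y => Z C C' d.
suff [W HW] : exists W, step_sem rs m p z (rect 1 2) C C' d W.
  by exists W; have [? ? ? ? ?] := stat Z.
have [tm|/not_all_ex_not[W nt]] :=
    classic (forall W, time_sem (rect 1 2) z C C' W); last by exists W; left.
have [t [col col' pos]] := time_num _ _ _ _ two tm.
have ltT : t < T by move: pos; rewrite zE /zf; case: ifP.
have [v /(In_nth _ idle)[i lti Ev] [Hch Hg]] := Hc t ltT.
have [cl|/not_all_ex_not[W nc]] := classic (forall W, cell_sem C C' W (d i)); last first.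
  by exists W; right; exists i => //; left.
exists part11; right; exists i => //; right; rewrite Ev.
have num := cell_num _ _ _ _ col col' cl _ erefl.
split=> [|r _|j ltj].
- apply: (proj2 (change_num _ _ _ _ _ num)).
  by rewrite !zE /zf ltT (ltnW ltT); lia.
- apply: (proj2 (change_num _ _ _ _ _ num)).
  rewrite !pE /f ltT (ltnW ltT); have := Hch r.
  by case: (change v r) => /=; lia.
- have [H1 _ _ _] := num (p (nth (0, 0) (guards v) j).1).
  have [H2 _ _ _] := num (p (nth (0, 0) (guards v) j).2).
  rewrite H1 H2 !pE /f (ltnW ltT) Hg //.
  by apply/(In_nth _ (0, 0)); exists j.
Qed.

Lemma change_inv e x y :
  (forall b, match e with DSame => b.+1 | DInc => b | DDec => b.+2 end <= x <-> b <= y) ->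
  x = match e with DSame => y.+1 | DInc => y | DDec => y.+2 end.
Proof. by move=> H; have := H y; have := H y.+1; case: e H => _; lia. Qed.

(** The run is read back as the differences [p r - z]. Its final time is any row where [p 3] exceeds
    [z], even if [z] continues below. *)
Lemma vrun_of_matrix_sem rs m k : 0 < k -> 3 < m ->
  (forall v, List.In v rs -> vbounded m v) ->
  (exists p z s x y, forall Z C C' d, exists W,
    matrix_sem rs m k p z s x y Z C C' d W) ->
  vrun rs (init k) 3.
Proof.
move=> kpos m3 bnd [p [z [s [x [y H]]]]].
have stat Z : [/\ chain_sem k x y Z, two_sem s Z,
    ~ young_le part11 (y 0) /\ first_row_sem Z z (y 0),
    regs_sem m p z s x y Z & ~ young_le (p 3) z].
  by have [W [? []]] := H Z part11 part11 (fun _ _ => part11).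
have two : is_two s.
  by split; [have [_ []] := stat part11|have [_ []] := stat part11
            |move=> Z; have [_ []] := stat Z].
have row0 : pr (y 0) 1 = 0 by have [_ _ [/rowP]] := stat part11.
have yE i : i <= k -> pr (y i) 1 = 0 /\ pr (y i) 0 = pr (y 0) 0 + i.
  elim: i => [|i IH] le; first by rewrite addn0.
  have [row E] := IH (ltnW le).
  rewrite addnS -E; apply: row_succ => //.
  - by have [[_ /(_ i le)[]]] := stat part11.
  - by have [[_ /(_ i le)[]]] := stat part11.
  - by move=> W; have [[_ /(_ i le)[]]] := stat W.
have xE : x = y k by have [[]] := stat part11.
have startE r : pr (start x y r) 1 = 0 /\ pr (start x y r) 0 = pr (y 0) 0 + init k r.
  (* The flag of the initial label is measured by [y 1], which belongs to the chain because [k] is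
     positive. *)
  by rewrite initE /start xE; case: eqP => _; apply: yE => //; case: eqP.
have z0 : pr z 0 = pr (y 0) 0 by apply/first_rowP => // Z; have [_ _ []] := stat Z.
have zp r a : r < m -> pr z a <= pr (p r) a.
  by move=> lt; have [_ _ _ /(_ r lt)[/young_leP]] := stat part11.
have p0 r a : r < m -> pr z a = 0 -> pr (p r) a = 0.
  move=> lt za; have [_ _ _ /(_ r lt)[_ Hr _] _] := stat (rect a.+1 1).
  by move: Hr; rewrite (two_le _ _ two) !(col_le _ _ _ (col_rect _)) pr_rect /= za; lia.
have pinit r : r < m -> pr (p r) 0 = pr z 0 + init k r.
  move=> lt; have [rowS ES] := startE r; rewrite z0 -ES; apply/first_rowP => // Z.
  by have [_ _ _ /(_ r lt)[]] := stat Z.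
have [T HT] : exists a, pr z a < pr (p 3) a.
  apply: NNPP => nex; have [_ _ _ _ []] := stat part11.
  by apply/young_leP => a; rewrite leqNgt; apply/negP => lt; apply: nex; exists a.
(* Since [p 3] has no row beyond [z], row [T] of [z] is nonempty, so all times before [T] fall under
   [time_sem]. *)
have zT : 0 < pr z T.
  by rewrite lt0n; apply/eqP => zT0; move: HT; rewrite (p0 3) // zT0.
pose c t r := if r < m then pr (p r) t - pr z t else 0.
exists T, c; split.
- apply: functional_extensionality => r; rewrite /c.
  case: ltnP => lt; first by rewrite pinit // addKn.
  by rewrite initE; repeat case: eqP => //; lia.
- move=> t ltT.
  have zpos : 0 < pr z t.+1 by apply: leq_trans zT (pr_mono _ _ _ ltT).
  (* Genuine columns and rectangles cannot be refuted by any [W], so every choice of widths leaves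
     some rule passing at its own width. *)
  pose P i b := rule_sem (nth idle rs i) m p z (cells t b).
  have [|i lti Hi] := @finite_choice (size rs) P.
    move=> b; have [W [_ [_ _ _ _]]] :=
      H part11 (rect t.+2 1) (rect t.+3 1) (fun i => cells t (b i)).
    case=> [[]|[i lti [[]|Hi]]]; [exact: cells_time|exact: cells_sem|by exists i].
  set v := nth idle rs i in Hi.
  have vin : List.In v rs by apply/(In_nth _ idle); exists i.
  have [bch bg] := bnd _ vin.
  have num b := cell_num _ _ _ (cells t b) (col_rect _) (col_rect _) (cells_sem t b) b
    (esym (congr1 predn (pr_row0 b.+1))).
  have rowsP e q : (forall b, change_sem e q (cells t b)) ->
      pr q t = match e with DSame => (pr q t.+1).+1 | DInc => pr q t.+1
                            | DDec => (pr q t.+1).+2 end.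
    move=> Hq; by apply: change_inv => b; apply: (proj1 (change_num _ _ _ _ _ (num b))).
  have zS : pr z t = (pr z t.+1).+1.
    by apply: (rowsP DSame) => b; have [] := Hi b.
  exists v => //; split=> [r|g gin].
    rewrite /c; case: ltnP => ltr; last by rewrite bch.
    have Er : pr (p r) t = _ := rowsP (change v r) _ (fun b => let: And3 _ h _ := Hi b in h r ltr).
    have := zp r t ltr; have := zp r t.+1 ltr.
    by case: (change v r) Er => /=; lia.
  have [lt1 lt2] := bg _ gin; rewrite /c lt1 lt2.
  have /(In_nth _ (0, 0))[j ltj Ej] := gin.
  have key b : b <= pr (p g.1) t <-> b <= pr (p g.2) t.
    have [_ _ /(_ j ltj)] := Hi b; rewrite Ej.
    have [H1 _ _ _] := num b (p g.1); have [H2 _ _ _] := num b (p g.2).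
    by rewrite H1 H2.
  suff -> : pr (p g.1) t = pr (p g.2) t by [].
  by apply/eqP; rewrite eqn_leq; apply/andP; split; apply/key.

- by rewrite /c m3; lia.
Qed.

(** * The first-order sentence *)

Definition fiff (a b : form) : form := FOr (FAnd a b) (FAnd (FNot a) (FNot b)).

Fixpoint fall (n : nat) (F : nat -> form) : form :=
  if n is n'.+1 then FAnd (F n') (fall n' F) else FEq TConst TConst.

Fixpoint fany (n : nat) (F : nat -> form) : form :=
  if n is n'.+1 then FOr (F n') (fany n' F) else FNot (FEq TConst TConst).

Lemma holds_and e a b : holds e (FAnd a b) <-> holds e a /\ holds e b.
Proof. by []. Qed.

Lemma holds_or e a b : holds e (FOr a b) <-> holds e a \/ holds e b.
Proof. by []. Qed.

Lemma holds_iff e a b : holds e (fiff a b) <-> (holds e a <-> holds e b).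
Proof. by rewrite /=; have [] := classic (holds e a); tauto. Qed.

Lemma holds_all e n F : holds e (fall n F) <-> forall i, i < n -> holds e (F i).
Proof.
elim: n => [|n IH] //=; rewrite IH; split=> [[Hn H] i|H].
  by rewrite ltnS leq_eqVlt => /orP[/eqP->|/H].
by split=> [|i lt]; apply: H => //; apply: ltnW.
Qed.

Lemma holds_any e n F : holds e (fany n F) <-> exists2 i, i < n & holds e (F i).
Proof.
elim: n => [|n IH] /=; first by split=> [|[]].
rewrite IH; split=> [[H|[i lt H]]|[i]]; [by exists n|by exists i => //; apply: ltnW|].
by rewrite ltnS leq_eqVlt => /orP[/eqP->|lt H]; [left|right; exists i].
Qed.

Lemma qfree_all n F : (forall i, qfree (F i)) -> qfree (fall n F).
Proof. by move=> H; elim: n => //= n ->; rewrite H. Qed.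

Lemma qfree_any n F : (forall i, qfree (F i)) -> qfree (fany n F).
Proof. by move=> H; elim: n => //= n ->; rewrite H. Qed.

(* Variables are numbered according to the quantifier block that binds them:
   0 and 1 (unused) in the last two blocks, residue 2 modulo 3 in the second
   block, all others in the first block. *)
Definition vW := TVar 0.
Definition vZ := TVar 2.
Definition vC := TVar 5.
Definition vC' := TVar 8.
Definition vd (i o : nat) := TVar (3 * pickle (i, o) + 11).
Definition vp (r : nat) := TVar (3 * r + 3).
Definition vz := TVar 4.
Definition vs := TVar 7.
Definition vx := TVar 10.
Definition vy (i : nat) := TVar (3 * i + 13).

Definition f_row_succ (W D D' : term) : form :=
  FAnd (FNot (FLe TConst D')) (FAnd (FNot (FLe D' D))
    (FOr (FLe TConst W) (FOr (FLe W D) (FLe D' W)))).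

Definition f_col_succ (W C C' : term) : form :=
  FAnd (FNot (FLe vs C')) (FAnd (FNot (FLe C' C))
    (FOr (FLe vs W) (FOr (FLe W C) (FLe C' W)))).

Definition f_rect (W R C D : term) : form :=
  fiff (FLe W R) (FAnd (FNot (FLe C W)) (FNot (FLe D W))).

Definition f_chain (k : nat) : form :=
  FAnd (FEq vx (vy k)) (fall k (fun i => f_row_succ vZ (vy i) (vy i.+1))).

Definition f_two : form :=
  FAnd (FNot (FLe TConst vs)) (FAnd (FNot (FLe vs TConst))
    (FOr (FLe TConst vZ) (FOr (FLe vs vZ) (FLe vZ TConst)))).

Definition f_first_row (q q' : term) : form :=
  FOr (FLe TConst vZ) (fiff (FLe vZ q) (FLe vZ q')).

Definition f_regs (m : nat) : form :=
  fall m (fun r =>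
    FAnd (FLe vz (vp r))
      (FAnd (FOr (FLe vs vZ) (FOr (FNot (FLe vZ (vp r))) (FLe vZ vz)))
        (f_first_row (vp r) (if r == 2 then vx else vy (r == 1))))).

Definition f_time : form :=
  FAnd (FNot (FLe vs vC)) (FAnd (FLe TConst vC)
    (FAnd (FLe vC vz) (f_col_succ vW vC vC'))).

Definition f_cell (i : nat) : form :=
  FAnd (FNot (FLe TConst (vd i 0)))
    (FAnd (FAnd (f_row_succ vW (vd i 0) (vd i 1)) (f_row_succ vW (vd i 1) (vd i 2)))
      (FAnd (f_rect vW (vd i 3) vC (vd i 0))
        (FAnd (f_rect vW (vd i 4) vC' (vd i 0))
          (FAnd (f_rect vW (vd i 5) vC (vd i 1)) (f_rect vW (vd i 6) vC (vd i 2)))))).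

Definition f_change (c : delta) (q : term) (i : nat) : form :=
  match c with
  | DSame => fiff (FLe (vd i 5) q) (FLe (vd i 4) q)
  | DInc => fiff (FLe (vd i 3) q) (FLe (vd i 4) q)
  | DDec => fiff (FLe (vd i 6) q) (FLe (vd i 4) q)
  end.

Definition f_rule (v : vrule) (m i : nat) : form :=
  FAnd (f_change DSame vz i)
    (FAnd (fall m (fun r => f_change (change v r) (vp r) i))
      (fall (size (guards v)) (fun j =>
        fiff (FLe (vd i 3) (vp (nth (0, 0) (guards v) j).1))
             (FLe (vd i 3) (vp (nth (0, 0) (guards v) j).2))))).

Definition f_step (rs : seq vrule) (m : nat) : form :=
  FOr (FNot f_time) (fany (size rs) (fun i =>
    FOr (FNot (f_cell i)) (f_rule (nth idle rs i) m i))).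

Definition f_machine (rs : seq vrule) (m : nat) : form :=
  FAnd f_two (FAnd (FAnd (FNot (FLe TConst (vy 0))) (f_first_row vz (vy 0)))
    (FAnd (f_regs m) (FAnd (FNot (FLe (vp 3) vz)) (f_step rs m)))).

Lemma qfree_machine rs m : qfree (f_machine rs m).
Proof.
have regs : qfree (f_regs m) by apply: qfree_all => r /=.
have change c q i : qfree (f_change c q i) by case: c.
have step : qfree (f_step rs m).
  apply/andP; split=> //; apply: qfree_any => i; apply/andP; split=> //.
  apply/andP; split=> //; apply/andP; split; first by apply: qfree_all.
  exact: qfree_all.
by do 2 (apply/andP; split=> //); apply/andP; split=> //; apply/andP; split.
Qed.

Definition reg_of (e : env) (r : nat) : partition := e (3 * r + 3).
Definition link_of (e : env) (i : nat) : partition := e (3 * i + 13).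
Definition cell_of (e : env) (i o : nat) : partition := e (3 * pickle (i, o) + 11).

Lemma holds_row_succ e W D D' : holds e (f_row_succ W D D') <->
  row_succ_sem (eval_term e W) (eval_term e D) (eval_term e D').
Proof. by split=> [[? [? ?]]|[? ? ?]]. Qed.

Lemma holds_rect e W R C D : holds e (f_rect W R C D) <->
  rect_sem (eval_term e W) (eval_term e R) (eval_term e C) (eval_term e D).
Proof. exact: holds_iff. Qed.

Lemma holds_chain e k : holds e (f_chain k) <-> chain_sem k (e 10) (link_of e) (e 2).
Proof.
split=> [[E /holds_all H]|[E H]]; split=> //.
  by move=> i lt; have /holds_row_succ := H i lt.
by apply/holds_all => i lt; apply/holds_row_succ/H.
Qed.

Lemma holds_first_row e q q' : holds e (f_first_row q q') <->
  first_row_sem (e 2) (eval_term e q) (eval_term e q').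
Proof.
split=> [/holds_or[H|/holds_iff H]|[H|H]]; [by left|by right|by left|].
by apply/holds_or; right; apply/holds_iff.
Qed.

Lemma holds_two e : holds e f_two <-> two_sem (e 7) (e 2).
Proof. by split=> [[? [? ?]]|[? ? ?]]. Qed.

Lemma holds_regs e m : holds e (f_regs m) <->
  regs_sem m (reg_of e) (e 4) (e 7) (e 10) (link_of e) (e 2).
Proof.
have E r : eval_term e (if r == 2 then vx else vy (r == 1)) = start (e 10) (link_of e) r.
  by rewrite /start; case: ifP.
rewrite holds_all; split=> H r /H.
  by move=> /holds_and[? /holds_and[? /holds_first_row]]; rewrite E.
by case=> ? ? ?; do 2 split=> //; apply/holds_first_row; rewrite E.
Qed.

Lemma holds_time e : holds e f_time <-> time_sem (e 7) (e 4) (e 5) (e 8) (e 0).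
Proof. by split=> [[? [? [? [? [? ?]]]]]|[? ? ? [? ? ?]]]. Qed.

Lemma holds_cell e i : holds e (f_cell i) <-> cell_sem (e 5) (e 8) (e 0) (cell_of e i).
Proof.
split.
  move=> /holds_and[? /holds_and[/holds_and[/holds_row_succ ? /holds_row_succ ?]]].
  move=> /holds_and[/holds_rect ? /holds_and[/holds_rect ?]].
  by move=> /holds_and[/holds_rect ? /holds_rect ?].
case=> ? [? ?] ? ? [? ?]; split=> //; split; first by split; apply/holds_row_succ.
by split; [|split; [|split]]; apply/holds_rect.
Qed.

Lemma holds_change e c q i : holds e (f_change c q i) <->
  change_sem c (eval_term e q) (cell_of e i).
Proof. by case: c; apply: holds_iff. Qed.

Lemma holds_rule e v m i : holds e (f_rule v m i) <-> rule_sem v m (reg_of e) (e 4) (cell_of e i).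
Proof.
split.
  move=> /holds_and[/holds_change ? /holds_and[/holds_all H1 /holds_all H2]].
  split=> // [r lt|j lt].
    exact/(holds_change _ _ (vp r))/H1.
  by have /holds_iff := H2 j lt.
case=> H0 H1 H2; split; first exact/holds_change.
split; apply/holds_all => i' lt; first exact/holds_change/H1.
exact/holds_iff/H2.
Qed.

Lemma holds_step e rs m : holds e (f_step rs m) <->
  step_sem rs m (reg_of e) (e 4) (e 7) (e 5) (e 8) (cell_of e) (e 0).
Proof.
split.
  move=> /holds_or[H|/holds_any[i lt /holds_or[H|H]]]; first by left=> /holds_time.
    by right; exists i => //; left=> /holds_cell.
  by right; exists i => //; right; apply/holds_rule.
case=> [H|[i lt [H|H]]]; first by left=> /holds_time.
  by right; apply/holds_any; exists i => //; left=> /holds_cell.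
by right; apply/holds_any; exists i => //; right; apply/holds_rule.
Qed.

Lemma holds_matrix e rs m k : holds e (FAnd (f_chain k) (f_machine rs m)) <->
  matrix_sem rs m k (reg_of e) (e 4) (e 7) (e 10) (link_of e) (e 2) (e 5) (e 8) (cell_of e) (e 0).
Proof.
split.
  move=> /holds_and[/holds_chain ? /holds_and[/holds_two ? /holds_and[]]].
  move=> /holds_and[? /holds_first_row ?].
  by move=> /holds_and[/holds_regs ? /holds_and[? /holds_step ?]].
case=> ? [[? ? ?] [? ?] ? ? ?]; split; first exact/holds_chain.
split; first exact/holds_two.
split; first by split=> //; apply/holds_first_row.
split; first exact/holds_regs.
by split=> //; apply/holds_step.
Qed.

(** * Quantifier prefixes *)

(** Every variable below [n] is bound, including those rebound further inside, where the inner
    binder prevails. This uniform shape makes the code a primitive recursion on [n]. *)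
Fixpoint exs (n : nat) (f : form) : form :=
  if n is n'.+1 then FEx n' (exs n' f) else f.

Fixpoint alls (n : nat) (f : form) : form :=
  if n is n'.+1 then FAll (3 * n' + 2) (alls n' f) else f.

Lemma holds_ext f e e' : (forall x, free_in x f -> e x = e' x) ->
  holds e f -> holds e' f.
Proof.
suff H : forall e e', (forall x, free_in x f -> e x = e' x) -> holds e f <-> holds e' f.
  by move=> /H[].
move=> {e e'}; elim: f => [t u|t u|g IH|g IHg h IHh|g IHg h IHh|x g IH|x g IH] e e' H /=.
- have E v : v = t \/ v = u -> eval_term e v = eval_term e' v.
    case: v => // n [] E; apply: H; rewrite -E /= eqxx ?orbT //.
  by rewrite !E; tauto.
- have E v : v = t \/ v = u -> eval_term e v = eval_term e' v.
    case: v => // n [] E; apply: H; rewrite -E /= eqxx ?orbT //.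
  by rewrite !E; tauto.
- by rewrite (IH e e').
- rewrite (IHg e e') ?(IHh e e') // => x Hx; apply: H; by rewrite /= Hx ?orbT.
- rewrite (IHg e e') ?(IHh e e') // => x Hx; apply: H; by rewrite /= Hx ?orbT.
- have E a : holds (upd e x a) g <-> holds (upd e' x a) g.
    apply: IH => w Hw; rewrite /upd; case: eqP => // neq; apply: H.
    by rewrite /= Hw andbT; apply/eqP => E; apply: neq.
  by split=> -[a /E]; exists a.
- have E a : holds (upd e x a) g <-> holds (upd e' x a) g.
    apply: IH => w Hw; rewrite /upd; case: eqP => // neq; apply: H.
    by rewrite /= Hw andbT; apply/eqP => E; apply: neq.
  by split=> Hf a; apply/E.
Qed.

Lemma free_exs x n f : free_in x (exs n f) = (n <= x) && free_in x f.
Proof.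
elim: n => //= n ->; rewrite andbA; congr andb.
by rewrite ltn_neqAle.
Qed.

Lemma free_alls x n f : free_in x (alls n f) -> free_in x f.
Proof. by elim: n => //= n IH /andP[_]. Qed.

Lemma holds_exs_agree e n f : holds e (exs n f) <->
  exists2 e' : env, (forall x, n <= x -> e' x = e x) & holds e' f.
Proof.
elim: n e => [|n IH] e /=.
  split=> [H|[e' E H]]; first by exists e.
  by apply: holds_ext H => x _; apply: E.
split=> [[a /IH[e' E H]]|[e' E H]].
  exists e' => // x lt; rewrite E ?(ltnW lt) // /upd.
  by case: eqP => // E1; rewrite E1 ltnn in lt.
exists (e' n); apply/IH; exists e' => // x le; rewrite /upd.
by case: eqP => [->//|/eqP neq]; apply: E; rewrite ltn_neqAle eq_sym neq.
Qed.

Lemma holds_alls_agree e n f : holds e (alls n f) <->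
  forall e' : env, (forall x, (x %% 3 != 2) || (3 * n <= x) -> e' x = e x) -> holds e' f.
Proof.
elim: n e => [|n IH] e.
  split=> [H e' E|]; last exact.
  by apply: holds_ext H => x _; rewrite E ?orbT.
split=> [H e' E|H a].
  apply/(proj1 (IH (upd e (3 * n + 2) (e' (3 * n + 2)))) (H _)) => x Hx.
  rewrite /upd; case: eqP => [->//|neq]; apply: E; lia.
apply/IH => e' E; apply: H => x Hx; rewrite E; last by lia.
by rewrite /upd; case: eqP => // Ex; lia.
Qed.

Lemma holds_exs e n f : (forall x, free_in x f -> x < n) ->
  holds e (exs n f) <-> exists e', holds e' f.
Proof.
move=> bnd; rewrite holds_exs_agree; split=> [[e' _ H]|[e' H]]; first by exists e'.
exists (fun x => if x < n then e' x else e x); first by move=> x; case: ltnP.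
by apply: holds_ext H => x /bnd ->.
Qed.

Lemma holds_alls e n f : (forall x, free_in x f -> x < 3 * n) ->
  holds e (alls n f) <->
  forall e' : env, (forall x, x %% 3 != 2 -> e' x = e x) -> holds e' f.
Proof.
move=> bnd; rewrite holds_alls_agree; split=> H e' E; last first.
  by apply: H => x Hx; apply: E; rewrite Hx.
apply: (@holds_ext _ (fun x => if x < 3 * n then e' x else e x)).
  by move=> x /bnd ->.
by apply: H => x /orP[/E->|]; case: ltnP.
Qed.

(** The prefix depends on [k] only: for [k = code B] it covers all free variables of the matrix, as
    these are bounded by codes. [FAll 1] supplies the fourth block of [Sigma 4]. *)
Definition sentence_of (k : nat) (B : form) : form :=
  exs (3 * k + 20) (alls (k + 20) (FEx 0 (FAll 1 (FAnd (f_chain k) B)))).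

Lemma free_chain k x : free_in x (f_chain k) -> x < 3 * k + 20.
Proof.
rewrite [free_in _ _]/= => /orP[]; first by lia.
move: {-2}k (leqnn k); elim=> [|j IH] lt //= /orP[|/IH]; by lia.
Qed.

(** * Pairing function, injectivity of codes and bounds on variables *)

Definition tri (n : nat) : nat := (n * n.+1)./2.

Lemma triS n : tri n.+1 = n.+1 + tri n.
Proof.
rewrite /tri; have -> : n.+1 * n.+2 = n.+1.*2 + n * n.+1 by lia.
by rewrite halfD odd_double doubleK add0n.
Qed.

Lemma tri_mono m n : m <= n -> tri m <= tri n.
Proof.
move=> le; rewrite -(subnKC le); elim: (n - m) => [|d IH]; first by rewrite addn0.
by rewrite addnS triS; apply: leq_trans IH _; apply: leq_addl.
Qed.

Lemma leq_tri n : n <= tri n.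
Proof. by case: n => // n; rewrite triS leq_addr. Qed.

Lemma cpairE a b : cpair a b = tri (a + b) + b.
Proof. by []. Qed.

Lemma leq_cpairl a b : a <= cpair a b.
Proof. by rewrite cpairE; have := leq_tri (a + b); lia. Qed.

Lemma leq_cpairr a b : b <= cpair a b.
Proof. by rewrite cpairE leq_addl. Qed.

(** The sum [a + b] is determined as the index of the interval between consecutive triangular
    numbers that contains the code. *)
Lemma cpair_inj a b a' b' : cpair a b = cpair a' b' -> a = a' /\ b = b'.
Proof.
rewrite !cpairE => E.
have lt s s' c c' : s < s' -> c <= s -> tri s + c <> tri s' + c'.
  by move=> /tri_mono; rewrite triS; lia.
have [/lt H|/lt H|Es] := ltngtP (a + b) (a' + b'); last by move: E; rewrite Es; lia.
  by case: (H b b'); [lia|].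
by case: (H b' b); [lia|].
Qed.

Lemma code_term_inj t u : code_term t = code_term u -> t = u.
Proof. by case: t u => [n|] [m|] //= /cpair_inj[] // _ ->. Qed.

Lemma code_inj f g : code f = code g -> f = g.
Proof.
elim: f g => [t u|t u|f IH|f IHf h IHh|f IHf h IHh|x f IH|x f IH]
  [t' u'|t' u'|f'|f' h'|f' h'|x' f'|x' f'] //= /cpair_inj[] //.
- by move=> _ /cpair_inj[/code_term_inj-> /code_term_inj->].
- by move=> _ /cpair_inj[/code_term_inj-> /code_term_inj->].
- by move=> _ /IH->.
- by move=> _ /cpair_inj[/IHf-> /IHh->].
- by move=> _ /cpair_inj[/IHf-> /IHh->].
- by move=> _ /cpair_inj[-> /IH->].
- by move=> _ /cpair_inj[-> /IH->].
Qed.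

Lemma free_in_code x f : free_in x f -> x <= code f.
Proof.
have ct t : term_has_var x t -> x <= code_term t.
  by case: t => //= n /eqP->; apply: leq_cpairr.
have r a b c : x <= c -> x <= cpair a (cpair b c).
  by move=> H; apply: leq_trans (leq_cpairr _ _); apply: leq_trans (leq_cpairr _ _).
have l a b c : x <= b -> x <= cpair a (cpair b c).
  by move=> H; apply: leq_trans (leq_cpairr _ _); apply: leq_trans (leq_cpairl _ _).
elim: f => [t u|t u|f IH|f IHf h IHh|f IHf h IHh|y f IH|y f IH] /=.
- by case/orP=> /ct H; [apply: l|apply: r].
- by case/orP=> /ct H; [apply: l|apply: r].
- by move=> /IH H; apply: leq_trans (leq_cpairr _ _).
- by case/orP=> [/IHf|/IHh] H; [apply: l|apply: r].
- by case/orP=> [/IHf|/IHh] H; [apply: l|apply: r].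
- by move=> /andP[_ /IH]; apply: r.
- by move=> /andP[_ /IH]; apply: r.
Qed.

Lemma free_matrix B x : free_in x (FAnd (f_chain (code B)) B) -> x < 3 * code B + 20.
Proof.
by rewrite [free_in _ _]/= => /orP[/free_chain//|/free_in_code]; lia.
Qed.

Lemma free_tail x f : free_in x (FEx 0 (FAll 1 f)) -> free_in x f.
Proof. by move=> /= /andP[_ /andP[]]. Qed.

Lemma sentence_ofP B : sentence (sentence_of (code B) B).
Proof.
move=> x; rewrite free_exs; apply/negP => /andP[le].
by move=> /free_alls/free_tail/free_matrix; rewrite ltnNge le.
Qed.

(** * Prenex form and meaning of the sentence *)

Lemma Pi_alls n f : Defs.Sigma 2 f -> Defs.Pi 3 (alls n.+1 f).
Proof. by move=> H; elim: n => [|n IH]; [apply: PiStart|apply: PiMore]. Qed.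

Lemma Sigma_exs n f : Defs.Pi 3 f -> Defs.Sigma 4 (exs n.+1 f).
Proof. by move=> H; elim: n => [|n IH]; [apply: SigmaStart|apply: SigmaMore]. Qed.

Lemma qfree_chain k : qfree (f_chain k).
Proof. exact: qfree_all. Qed.

Lemma Sigma_sentence_of k B : qfree B -> Defs.Sigma 4 (sentence_of k B).
Proof.
move=> qB; rewrite /sentence_of !addnS; apply: Sigma_exs; apply: Pi_alls.
apply: SigmaStart; apply: PiStart; apply: Sigma0.
by apply/andP; split; first exact: qfree_chain.
Qed.

Lemma upd_neq01 e w a x : 1 < x -> upd (upd e 0 w) 1 a x = e x.
Proof. by case: x => [|[]]. Qed.

Lemma reg_of_upd e w a : reg_of (upd (upd e 0 w) 1 a) = reg_of e.
Proof. by apply: functional_extensionality => r; apply: upd_neq01; lia. Qed.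

Lemma link_of_upd e w a : link_of (upd (upd e 0 w) 1 a) = link_of e.
Proof. by apply: functional_extensionality => i; apply: upd_neq01; lia. Qed.

Lemma cell_of_upd e w a : cell_of (upd (upd e 0 w) 1 a) = cell_of e.
Proof.
apply: functional_extensionality => i; apply: functional_extensionality => o.
by apply: upd_neq01; lia.
Qed.

Lemma holds_sentence_of e rs m : let B := f_machine rs m in let k := code B in
  holds e (sentence_of k B) <->
  exists p z s x y, forall Z C C' d, exists W,
    matrix_sem rs m k p z s x y Z C C' d W.
Proof.
move=> B k; rewrite holds_exs; last first.
  by move=> x /free_alls/free_tail/free_matrix.
have bnd2 x : free_in x (FEx 0 (FAll 1 (FAnd (f_chain k) B))) -> x < 3 * (k + 20).
  by move=> /free_tail/free_matrix; rewrite -/k; lia.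
split=> [[e1 /(holds_alls _ _ _ bnd2) H]|[p [z [s [x [y H]]]]]].
  exists (fun r => e1 (3 * r + 3)), (e1 4), (e1 7), (e1 10), (fun i => e1 (3 * i + 13)).
  move=> Z C C' d.
  (* Variables 2, 5, 8 are [Z], [C], [C']; from 11 on, residue 2 decodes to a pair indexing [d],
     with [Z] as filler where decoding fails. *)
  pose e2 : env := fun v => if v %% 3 != 2 then e1 v else
    if v == 2 then Z else if v == 5 then C else if v == 8 then C' else
    oapp (fun io => d io.1 io.2) Z (unpickle ((v - 11) %/ 3)).
  have [W HW] := H e2 (fun v Hv => ltac:(by rewrite /e2 Hv)).
  exists W; have /holds_matrix := HW (e1 1).
  rewrite reg_of_upd link_of_upd cell_of_upd.
  have -> : reg_of e2 = fun r => e1 (3 * r + 3).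
    apply: functional_extensionality => r; rewrite /reg_of /e2.
    by case: ifP => //; lia.
  have -> : link_of e2 = fun i => e1 (3 * i + 13).
    apply: functional_extensionality => i; rewrite /link_of /e2.
    by case: ifP => //; lia.
  have -> // : cell_of e2 = d.
  apply: functional_extensionality => i; apply: functional_extensionality => o.
  rewrite /cell_of; move E : (pickle (i, o)) => n; rewrite /e2.
  have -> : (3 * n + 11 - 11) %/ 3 = n by lia.
  by rewrite -E pickleK E; repeat (case: ifP; first by lia) => *.
(* The single variables 4, 7 and 10 come first, since they share residue 1 with the chain [y];
   multiples of 3 hold the registers. *)
pose e1 : env := fun v => if v == 4 then z else if v == 7 then s else
  if v == 10 then x else if v %% 3 == 0 then p (v %/ 3).-1 else y ((v - 13) %/ 3).
exists e1; apply/(holds_alls _ _ _ bnd2) => e2 E.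
have [W HW] := H (e2 2) (e2 5) (e2 8) (cell_of e2).
exists W => a; apply/holds_matrix.
rewrite reg_of_upd link_of_upd cell_of_upd.
have -> : reg_of e2 = p.
  apply: functional_extensionality => r; rewrite /reg_of E; last by lia.
  rewrite /e1; have -> : ((3 * r + 3) %/ 3).-1 = r by lia.
  by repeat (case: ifP; first by lia) => *; case: ifP => //; lia.
have -> : link_of e2 = y.
  apply: functional_extensionality => i; rewrite /link_of E; last by lia.
  rewrite /e1; have -> : (3 * i + 13 - 13) %/ 3 = i by lia.
  by repeat (case: ifP; first by lia) => *.
by rewrite -[upd _ 1 a 0]/W !upd_neq01 // (E 4) // (E 7) // (E 10).
Qed.

(** * Recursiveness of the codes *)

(** Functions of whole argument lists, with missing arguments read as 0, which avoids bookkeeping of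
    arities. *)
Definition rec_fun (F : seq nat -> nat) : Prop :=
  exists f, forall v, reval f v (F v).

Lemma rec_ext F G : F =1 G -> rec_fun F -> rec_fun G.
Proof. by move=> E [f Hf]; exists f => v; rewrite -E. Qed.

Lemma rec_nth i : rec_fun (fun v => nth 0 v i).
Proof. by exists (RProj i) => v; constructor. Qed.

Lemma rec_succ F : rec_fun F -> rec_fun (fun v => (F v).+1).
Proof.
move=> [f Hf]; exists (RComp RSucc [:: f]) => v.
by apply: (@ev_comp _ _ _ [:: F v]); repeat constructor.
Qed.

Lemma rec_const c : rec_fun (fun=> c).
Proof. by elim: c => [|c /rec_succ //]; exists RZero => v; constructor. Qed.

Definition prim_rec (F : nat -> nat) (G : nat -> nat -> nat -> nat) (p n : nat) : nat :=
  nat_rect (fun=> nat) (F p) (fun i z => G i z p) n.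

Lemma rec_prim F G N P :
  rec_fun (fun v => F (nth 0 v 0)) ->
  rec_fun (fun v => G (nth 0 v 0) (nth 0 v 1) (nth 0 v 2)) ->
  rec_fun N -> rec_fun P -> rec_fun (fun v => prim_rec F G (P v) (N v)).
Proof.
move=> [f Hf] [g Hg] [n Hn] [p Hp]; exists (RComp (RPrim f g) [:: n; p]) => v.
apply: (@ev_comp _ _ _ [:: N v; P v]); first by repeat constructor.
elim: (N v) => [|i IH]; first by apply: ev_prim0; apply: (Hf [:: P v]).
by apply: ev_primS IH _; apply: (Hg [:: i; _; P v]).
Qed.

Lemma rec_add F G : rec_fun F -> rec_fun G -> rec_fun (fun v => F v + G v).
Proof.
move=> HF HG; apply: (@rec_ext (fun v => prim_rec id (fun _ z _ => z.+1) (G v) (F v))).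
  by move=> v; rewrite /prim_rec; elim: (F v) => //= n ->.
apply: rec_prim => //; first exact: rec_nth.
exact/rec_succ/rec_nth.
Qed.

Lemma rec_tri F : rec_fun F -> rec_fun (fun v => tri (F v)).
Proof.
move=> HF; apply: (@rec_ext (fun v => prim_rec id (fun i z _ => i.+1 + z) 0 (F v))).
  by move=> v; rewrite /prim_rec; elim: (F v) => // n IH; rewrite triS -IH.
apply: rec_prim => //; [exact: rec_nth| |exact: rec_const].
by apply: rec_add; [apply: rec_succ|]; apply: rec_nth.
Qed.

Lemma rec_cpair F G : rec_fun F -> rec_fun G -> rec_fun (fun v => cpair (F v) (G v)).
Proof.
by move=> HF HG; apply: rec_add => //; apply: rec_tri; apply: rec_add.
Qed.

Lemma rec_mul3 F : rec_fun F -> rec_fun (fun v => 3 * F v).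
Proof.
move=> HF; apply: (@rec_ext (fun v => F v + (F v + F v))); first by move=> v; lia.
by do 2 apply: rec_add => //.
Qed.

Lemma code_exs n f :
  code (exs n f) = prim_rec id (fun i z _ => cpair 5 (cpair i z)) (code f) n.
Proof. by elim: n => //= n ->. Qed.

Lemma code_alls n f :
  code (alls n f) = prim_rec id (fun i z _ => cpair 6 (cpair (3 * i + 2) z)) (code f) n.
Proof. by elim: n => //= n ->. Qed.

Lemma code_all n F (G : nat -> nat) : (forall i, code (F i) = G i) ->
  code (fall n F) =
  prim_rec (fun=> cpair 1 (cpair (cpair 1 0) (cpair 1 0)))
    (fun i z _ => cpair 3 (cpair (G i) z)) 0 n.
Proof. by move=> E; elim: n => //= n ->; rewrite E. Qed.

Ltac rec_tac :=
  repeat first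
    [ assumption | exact: rec_nth | exact: rec_const | apply: rec_cpair
    | apply: rec_mul3 | apply: rec_succ | apply: rec_add ].

Lemma rec_code_chain N : rec_fun N -> rec_fun (fun v => code (f_chain (N v))).
Proof.
move=> HN; rewrite /f_chain.
pose G i := code (f_row_succ vZ (vy i) (vy i.+1)).
apply: (@rec_ext (fun v => cpair 3 (cpair (cpair 1 (cpair (code_term vx) (cpair 0 (3 * N v + 13))))
   (prim_rec (fun=> cpair 1 (cpair (cpair 1 0) (cpair 1 0)))
             (fun i z _ => cpair 3 (cpair (G i) z)) 0 (N v))))).
  by move=> v; rewrite [RHS]/= (@code_all _ _ G).
have HG F : rec_fun F -> rec_fun (fun v => G (F v)).
  by move=> HF; rewrite /G [X in rec_fun X]/=; rec_tac.
rec_tac; apply: rec_prim; rec_tac; apply: HG; rec_tac.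
Qed.

(** The arithmetic counterpart of [sentence_of]: the formula [B] enters only through its code, for
    which [k] itself is inserted. *)
Definition diag (k : nat) : nat :=
  prim_rec id (fun i z _ => cpair 5 (cpair i z))
    (prim_rec id (fun i z _ => cpair 6 (cpair (3 * i + 2) z))
       (cpair 5 (cpair 0 (cpair 6 (cpair 1 (cpair 3 (cpair (code (f_chain k)) k))))))
       (k + 20))
    (3 * k + 20).

Lemma code_sentence_of B : code (sentence_of (code B) B) = diag (code B).
Proof. by rewrite /sentence_of code_exs code_alls. Qed.

Lemma rec_diag : exists f, forall k, reval f [:: k] (diag k).
Proof.
suff [f Hf] : rec_fun (fun v => diag (nth 0 v 0)) by exists f => k; apply: (Hf [:: k]).
apply: rec_prim; rec_tac.
have chain := rec_code_chain _ (rec_nth 0).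
by apply: rec_prim; rec_tac; apply: rec_prim; rec_tac.
Qed.

(** * Diagonalization *)

(** [B] is built from the machine of [g] before any input is chosen, so its own code can then be
    supplied as input through [f_chain]. *)
Lemma representable g : exists B, qfree B /\
  forall e, holds e (sentence_of (code B) B) <-> reval g [:: code B] 0.
Proof.
(* Data register 1 becomes register 2 under [enc], where [start] puts the input. The final test
   blocks unless the result is 0. *)
pose P := PSeq (compile g [:: 1] 2 3) (PAct (AEq 2 0)).
have [m m3 bnd] := vbounded_rules (rules P 0 1 2).
set rs := map _ _ in bnd; pose B := f_machine rs m.
exists B; split=> [|e]; first exact: qfree_machine.
have kpos : 0 < code B by apply: leq_trans (leq_cpairl _ _).
have semP k : (exists s', sem P (setr (fun=> 0) 1 k) s') <-> reval g [:: k] 0.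
  have rdy : comp_ready [:: 1] 2 3 (setr (fun=> 0) 1 k).
    by split=> //; case=> [|[]].
  have E : map (setr (fun=> 0) 1 k) [:: 1] = [:: k] by [].
  split=> [[s' [u /(comp_correctP _ _ _ _ _ _ rdy)[y Hy ->]]]|H].
    case=> y0 _; have {}y0 : y = 0 by move: y0; rewrite setr_eq.
    by rewrite y0 in Hy.
  exists (setr (setr (fun=> 0) 1 k) 2 0), (setr (setr (fun=> 0) 1 k) 2 0) => //.
  by apply/comp_correctP => //; exists 0; rewrite ?E.
rewrite holds_sentence_of -semP -vrun_rules.
split; first exact: vrun_of_matrix_sem.
exact: matrix_sem_of_vrun.
Qed.

Theorem theorem3p15 : ~ recursive_set (Sigma_theory_Ystar 4).
Proof.
case=> D HD; have [df Hdf] := rec_diag.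
(* The sentence obtained says that [D] answers 0 on the code of this very sentence. *)
have [B [qB HB]] := representable (RComp D [:: df]).
set k := code B in HB; set S := sentence_of k B in HB.
have gE y : reval D [:: diag k] y -> reval (RComp D [:: df]) [:: k] y.
  by move=> Hy; apply: ev_comp Hy; repeat constructor.
have thy : true_in_Ystar S <-> Sigma_theory_Ystar 4 (diag k).
  split=> [H|[f [Ef [_ [_ Hf]]]]].
    exists S; rewrite code_sentence_of; do 2 split=> //; first exact: sentence_ofP.
    by split; first exact: Sigma_sentence_of.
  by have <- : f = S by apply: code_inj; rewrite code_sentence_of.
have [H1 H0] := HD (diag k).
(* If the code is in the theory, [D] answers 1 while truth of [S] demands 0; if not, [D] answers 0,
   which makes [S] true. *)
have [H|H] := classic (Sigma_theory_Ystar 4 (diag k)).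
  have /HB gk : holds (fun=> part11) S := proj2 thy H _.
  by have := reval_functional _ _ _ _ (gE _ (H1 H)) gk.
by case: (H); apply/thy => e; apply/HB; apply/gE/H0.
Qed.
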